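(* There is an absolute constant $c>0$ such that for every positive integer $n$ and every $(n+1)$-regular graph $G$ on $2n$ vertices, if $S$ is a uniformly random subset of $V(G)$, then $$\mathbb{P}(G[S] \text{ is Hamiltonian}) \ge c.$$
   Context: All graphs are finite and simple. $G[S]$ denotes the subgraph of $G$ induced by $S$. A graph is Hamiltonian if it has a cycle (with at least 3 vertices) through all its vertices. *)

(* Defs.v *)
From mathcomp Require Import all_boot all_order all_algebra.
From mathcomp Require Import boolp reals.

Set Implicit Arguments.
Unset Strict Implicit.
Unset Printing Implicit Defensive.

Import Order.TTheory GRing.Theory Num.Theory.

Record sgraph := SGraph {
  vertex :> finType;
  adj : rel vertex;
  adj_sym : symmetric adj;
  adj_irrefl : irreflexive adj }.

Definition degree (G : sgraph) (x : G) : nat := #|[pred y : G | adj x y]|.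

Definition regular (d : nat) (G : sgraph) : Prop :=
  forall x : G, degree x = d.

Section Induced.
Variables (G : sgraph) (S : {set G}).

Definition induced_adj : rel {x : G | x \in S} :=
  fun x y => adj (val x) (val y).

Lemma induced_adj_sym : symmetric induced_adj.
Proof. by move=> x y; exact: adj_sym. Qed.

Lemma induced_adj_irrefl : irreflexive induced_adj.
Proof. by move=> x; exact: adj_irrefl. Qed.

Definition induced : sgraph := SGraph induced_adj_sym induced_adj_irrefl.

End Induced.

(* A cycle is given by the sequence of its vertices. The bound on the size is
   needed because [cycle] also accepts [::] and, for an edge xy, [:: x; y]. *)
Definition hamiltonian (G : sgraph) : Prop :=
  exists p : seq G,
    [/\ 3 <= size p, ucycle (@adj G) p & forall x : G, x \in p].

Local Open Scope ring_scope.

(* Probability of the event E for a uniformly random element of Omega; the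
   value is the junk 0 if Omega is empty, which {set T} never is. *)
Definition unif_pr (R : realType) (Omega : finType) (E : Omega -> Prop) : R :=
  #|[pred w : Omega | `[< E w >]]|%:R / #|Omega|%:R.

(* Main.v *)
(* The argument is a stability analysis at the scale of the fluctuations of a
   random set S. In G[S] every degree is |S|/2 - O(t) with t slightly above
   sqrt n, so that Dirac's theorem just fails. If G[S] is not Hamiltonian, the
   Posa rotations of a longest path produce about |S|/2 vertices having the same
   neighbourhood up to O(t) elements, and by concentration G itself contains
   about n such vertices. So either G[S] is Hamiltonian with high probability,
   or G is close to two disjoint cliques or to a complete bipartite graph.

   Near two cliques, two disjoint edges cross the partition, they lie in S with
   probability 1/16, and then S is covered by two Hamiltonian paths. Near a
   complete bipartite graph with sides A and B, suppose that the excess of S on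
   the side of A is c sqrt n above its mean; this has probability bounded below.
   Then the vertices of S on the side of B become universal in the Bondy-Chvatal
   closure of G[S], and it remains to cover the rest of S by as many paths as
   there are universal vertices. Regularity forces enough edges inside A, or
   inside B, in which case the two sides are exchanged. *)

Require Import Defs.
From mathcomp Require Import all_boot all_order all_algebra.
From mathcomp Require Import boolp reals sequences exp.
From mathcomp Require Import zify ring lra.

Set Implicit Arguments.
Unset Strict Implicit.
Unset Printing Implicit Defensive.

(** * Cycles and the Bondy-Chvatal closure *)

(** The obstacle is that degrees in G[S] fluctuate around |S|/2 by about sqrt n, and a union bound
    over all vertices controls them only up to the larger [tau]. Near a complete bipartite graph a
    lucky S must therefore help all vertices of B at once. It can, because their neighbourhoods all
    equal A up to O(d) elements: twice the degree of b in S, minus |S|, is the deviation of the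
    excess of S on A, which is the same for all b, plus fluctuations of sets of size O(d). With sqrt
    d well below sqrt n, these stay below [q], of order sqrt n, for all b simultaneously, while the
    excess exceeds its mean by [4 * q] with probability bounded below. This fixes the scales.
    Counting pairs of a twin and an exceptional vertex gives the partition up to O(d) once n tau is
    at most of order d^2, which leaves room for d = o(n) and for q between sqrt d and tau. The
    degree n + 1, instead of n, supplies the crossing edges in one case and linearly many inner
    edges in the other. *)

Section Cycles.
Variable T : finType.
Implicit Types (e : rel T) (S : {set T}) (x y : T) (p s : seq T).

Definition nbrs e x : {set T} := [set y | e x y].

Definition ham e S : Prop :=
  exists p, [/\ 2 < size p, cycle e p, uniq p & p =i S].

Lemma cycle_of_crossing e a r1 b r2 : symmetric e ->
  path e a (r1 ++ b :: r2) -> e a b -> e (last a r1) (last b r2) ->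
  cycle e (a :: r1 ++ rev (b :: r2)).
Proof.
move=> es; rewrite cat_path /= => /and3P[pr1 _ pr2] eab el.
have: path e (last a (b :: r2)) (rev (belast a (b :: r2))).
  rewrite rev_path /= es eab /=.
  by rewrite (eq_path (e' := e)) // => u v; rewrite es.
rewrite /= rev_cons => pr.
by rewrite rcons_cat cat_path pr1 lastI rev_rcons /= el.
Qed.

Lemma cycle_of_crossing_nth e s x0 k : symmetric e ->
  sorted e s -> k.+1 < size s ->
  e (nth x0 s 0) (nth x0 s k.+1) -> e (nth x0 s k) (last x0 s) ->
  exists2 c, perm_eq c s & cycle e c.
Proof.
move=> es ss lk e1 e2; have lk' : k < size s by apply: ltnW.
case: s => [//|a s] in ss lk lk' e1 e2 *.
rewrite /= in ss e1 lk e2.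
exists (a :: take k s ++ rev (drop k s)).
  rewrite perm_cons -{3}(cat_take_drop k s) perm_cat2l perm_rev.
  by rewrite perm_refl.
have dE : drop k s = nth x0 s k :: drop k.+1 s by apply: drop_nth.
have la : last a (take k s) = nth x0 (a :: s) k.
  rewrite (last_nth x0) size_takel ?(ltnW lk) //.
  by case: k {dE lk' e1 e2 lk} => //= k; rewrite nth_take.
have lb : last (nth x0 s k) (drop k.+1 s) = last a s.
  by rewrite -{3}(cat_take_drop k s) last_cat dE.
rewrite dE; apply: cycle_of_crossing => //; first by rewrite -dE cat_take_drop.
by rewrite la lb.
Qed.

(** Ore's pigeonhole: the positions of the neighbours of the first vertex, moved back by one, and
    those of the neighbours of the last vertex all lie among |S| - 1 positions. They number at least
    |S|, so a position is shared, and the two edges there close a cycle by crossing. *)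
Lemma ham_path_of_crossing e S p : symmetric e -> 2 < #|S| ->
  sorted e p -> uniq p -> p =i S ->
  forall x0, #|S| <= #|nbrs e (head x0 p) :&: S| + #|nbrs e (last x0 p) :&: S| ->
  e (head x0 p) (head x0 p) = false -> e (last x0 p) (last x0 p) = false ->
  ham e S.
Proof.
move=> es S3 sp up pS x0 deg irr1 irr2.
have szp : size p = #|S| by rewrite -(eq_card pS) (card_uniqP up).
set a := head x0 p in deg irr1; set b := last x0 p in deg irr2.
have aE : nth x0 p 0 = a by rewrite nth0.
pose v := nth x0 p.
have [[k /andP[lk /andP[k1 k2]]]|no] :=
  pselect (exists k, (k.+1 < size p) && (e a (v k.+1) && e (v k) b)).
  have [|c cp cc] := @cycle_of_crossing_nth e p x0 k es sp lk _ k2.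
    by rewrite aE.
  exists c; split=> //; first by rewrite (perm_size cp) szp.
    by rewrite (perm_uniq cp).
  by move=> z; rewrite (perm_mem cp) pS.
pose m := size p.
have cardE (x : T) : #|nbrs e x :&: S| = \sum_(0 <= k < m) e x (v k).
  rewrite /m -(big_nth x0 predT (fun z => nat_of_bool (e x z))).
  rewrite big_uniq //= -sum1_card big_mkcond [RHS]big_mkcond /=.
  apply: eq_bigr => z _; rewrite !inE pS.
  by case: (e x z); case: (z \in S).
have m1 : m = m.-1.+1 by rewrite /m szp; move: S3; case: #|S|.
move: deg; rewrite !cardE m1 big_nat_recl // big_nat_recr //= /v aE irr1.
rewrite nth_last irr2 add0n addn0 -big_split /= => deg.
have : \sum_(0 <= i < m.-1) (e a (nth x0 p i.+1) + e b (nth x0 p i)) <= m.-1.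
  rewrite -{2}(muln1 m.-1) -{2}(subn0 m.-1) -sum_nat_const_nat.
  rewrite big_nat [leqRHS]big_nat; apply: leq_sum => i /andP[_ im].
  case E1: (e a _); case E2: (e b _) => //; case: no; exists i.
  by rewrite E1 es E2 !andbT -/m m1.
by move=> /(leq_trans deg); rewrite -szp -/m {1}m1 ltnn.
Qed.


Definition add_edge e u v : rel T :=
  fun x y => [|| e x y, (x == u) && (y == v) | (x == v) && (y == u)].

Lemma add_edge_sym e u v : symmetric e -> symmetric (add_edge e u v).
Proof.
move=> es x y; rewrite /add_edge es; congr (_ || _).
by rewrite orbC; congr (_ || _); rewrite andbC.
Qed.

Lemma sub_path_in e e' x p : {in x :: p &, subrel e e'} ->
  path e x p -> path e' x p.
Proof.
elim: p x => //= y p IH x see /andP[exy pp]; apply/andP; split.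
  by apply: see exy; rewrite !inE eqxx ?orbT.
by apply: IH pp => a b ap bp; apply: see; rewrite inE ?ap ?bp orbT.
Qed.

(** A Hamiltonian cycle through the new edge becomes, without that edge, a Hamiltonian path of [e]
    between u and v, to which the pigeonhole applies. With the cycle rotated to start at u, the new
    edge can only be its first or its last one. *)
Lemma ham_add_edge e S u v : symmetric e -> irreflexive e ->
  u \in S -> v \in S -> u != v ->
  #|S| <= #|nbrs e u :&: S| + #|nbrs e v :&: S| ->
  ham (add_edge e u v) S -> ham e S.
Proof.
move=> es ei uS vS uv deg [p [p3 cp up pS]].
have S3 : 2 < #|S| by rewrite -(eq_card pS) (card_uniqP up).
have [|i s rs] := @rot_to _ p u; first by rewrite pS.
rewrite -(size_rot i) -(rot_cycle i) -(rot_uniq i) rs in p3 cp up.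
have pS' : u :: s =i S by move=> z; rewrite -rs mem_rot pS.
case: s rs p3 cp up pS' => [|x [|y s]] // _ _ cp up pS'.
have us : u \notin [:: x, y & s] by move: up; rewrite cons_uniq => /andP[].
have xs : x \notin y :: s by move: up => /= /and3P[].
have lxy : last x (y :: s) = last y s by [].
have ls : last y s \in y :: s by apply: mem_last.
have [e1 pxs e2] : [/\ x != v -> e u x, path e x (y :: s) &
                       last y s != v -> e (last y s) u].
  move: cp; rewrite (cycle_path u) /= => /and4P[e2 e1 e3 e4]; split.
  - move=> xv; move: e1; rewrite /add_edge eqxx (negPf xv) (negPf uv) /= orbF.
    by [].
  - have e34 : path (add_edge e u v) x (y :: s) by rewrite /= e3 e4.
    apply: sub_path_in e34 => a b ap bp; rewrite /add_edge.
    have -> : (a == u) = false by apply: contraNF us => /eqP <-.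
    have -> : (b == u) = false by apply: contraNF us => /eqP <-.
    by rewrite andbF /= orbF.
  - move=> lv; move: e2; rewrite /add_edge (negPf lv) eqxx (negPf uv) /=.
    by rewrite andbF !orbF.
have [xv|/e1 eux] := eqVneq x v.
  have lv : last y s != v by apply: contraNneq xs => lv; rewrite xv -lv.
  apply: (@ham_path_of_crossing e S (rcons [:: x, y & s] u)) (u) _ _ _ => //.
  - by rewrite -[sorted _ _]/(path e x (rcons (y :: s) u)) rcons_path pxs e2.
  - by rewrite rcons_uniq us; move: up; rewrite cons_uniq => /andP[].
  - by move=> z; rewrite mem_rcons pS'.
  - by rewrite last_rcons /= xv addnC.
have [lv|/e2 elu] := eqVneq (last y s) v.
  apply: (@ham_path_of_crossing e S [:: u, x, y & s]) (u) _ _ _ => //.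
  - by rewrite /= eux.
  - by rewrite /= lv.
exists [:: u, x, y & s]; split => //.
by rewrite (cycle_path u) /= elu eux.
Qed.

(** Degrees only grow while the edges are added one by one, so a condition on the degrees of the
    initial [e] persists, and all of [e'] can be added in one layer. *)
Lemma ham_closure e e' S : symmetric e -> irreflexive e ->
  symmetric e' -> irreflexive e' -> subrel e e' ->
  {in S &, forall u v, e' u v -> ~~ e u v ->
     #|S| <= #|nbrs e u :&: S| + #|nbrs e v :&: S|} ->
  ham e' S -> ham e S.
Proof.
move=> + + es' ei'.
have [k] := ubnP #|[set w : T * T | [&& w.1 \in S, w.2 \in S, e' w.1 w.2 &
                       ~~ e w.1 w.2]]|.
elim: k e => // k IH e lek es ei see deg hS.
have [w0|[[u v]]] := set_0Vmem [set w : T * T | [&& w.1 \in S, w.2 \in S,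
                       e' w.1 w.2 & ~~ e w.1 w.2]].
  case: hS => p [p3 cp up pS]; exists p; split => //.
  apply: (@sub_in_cycle _ (mem S) e') cp.
    move=> a b aS bS ab; apply: contraT => nab.
    by have := in_set0 (a, b); rewrite -w0 inE /= aS bS ab nab.
  by apply/allP => z; rewrite pS.
rewrite inE /= => /and4P[uS vS e'uv neuv].
have uv : u != v by apply: contraTneq e'uv => ->; rewrite ei'.
apply: (@ham_add_edge e S u v) => //; first by apply: deg.
have sub1 : subrel e (add_edge e u v) by move=> a b ab; rewrite /add_edge ab.
apply: IH => //.
- rewrite -ltnS; apply: leq_trans lek; apply: proper_card.
  apply/properP; split.
    apply/subsetP => -[a b]; rewrite !inE /= => /and4P[-> -> ->] /=.
    by apply: contra => /sub1.
  exists (u, v); first by rewrite inE /= uS vS e'uv.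
  by rewrite inE /= /add_edge !eqxx orbT /= !andbF.
- exact: add_edge_sym.
- move=> x; rewrite /add_edge ei /=; apply/negP => /orP[] /andP[/eqP-> ].
    by rewrite (negPf uv).
  by rewrite eq_sym (negPf uv).
- move=> a b /or3P[/see //||] /andP[/eqP-> /eqP->] //.
  by rewrite es'.
- move=> a b aS bS ab nab; apply: leq_trans (deg a b aS bS ab _) _.
    by apply: contra nab => /sub1.
  by apply: leq_add; apply: subset_leq_card; apply: setSI; apply/subsetP => z;
    rewrite !inE => /sub1.
Qed.

End Cycles.

(** * Rotations of a longest path *)

Section CountingPositions.
Implicit Types (P Q : pred nat) (m k : nat).

Definition cnt m P := \sum_(0 <= i < m) P i.

Lemma cnt_le m P Q : (forall i, i < m -> P i -> Q i) -> cnt m P <= cnt m Q.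
Proof.
move=> PQ; rewrite /cnt big_nat [leqRHS]big_nat; apply: leq_sum => i /andP[_ im].
by case: (boolP (P i)) => // /(PQ _ im) ->.
Qed.

Lemma cntS m P : cnt m.+1 P = cnt m P + P m.
Proof. by rewrite /cnt big_nat_recr. Qed.

Lemma cntID m P Q : cnt m P = cnt m (predI P Q) + cnt m (predD P Q).
Proof.
rewrite /cnt -big_split /=; apply: eq_bigr => i _.
by case: (P i); case: (Q i).
Qed.

Lemma cntC m P : cnt m P + cnt m (predC P) = m.
Proof.
rewrite /cnt -big_split /= (eq_bigr (fun=> 1)) => [|i _]; last by case: (P i).
by rewrite sum_nat_const_nat subn0 muln1.
Qed.

Lemma cnt_leU m P Q1 Q2 :
  (forall i, i < m -> P i -> Q1 i || Q2 i) -> cnt m P <= cnt m Q1 + cnt m Q2.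
Proof.
move=> PQ; rewrite /cnt -big_split /= big_nat [leqRHS]big_nat.
apply: leq_sum => i /andP[_ im].
by case: (boolP (P i)) => // /(PQ _ im); case: (Q1 i); case: (Q2 i).
Qed.

Lemma cnt_leq_pos m P Q : (forall i, i < m -> P i -> Q i.+1) ->
  cnt m P <= cnt m.+1 Q.
Proof.
move=> PQ; rewrite /cnt big_nat_recl //; apply: leq_trans (leq_addl _ _).
rewrite big_nat [leqRHS]big_nat; apply: leq_sum => i /andP[_ im].
by case: (boolP (P i)) => // /(PQ _ im) ->.
Qed.

Lemma cnt1 m k : cnt m (pred1 k) <= 1.
Proof.
elim: m => [|m IH]; first by rewrite /cnt big_geq.
rewrite /cnt big_nat_recr //=.
have [->|_] := eqVneq m k; last by rewrite addn0.
rewrite big_nat big1 // => i /andP[_ ik]; by rewrite ltn_eqF.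
Qed.

Lemma cnt_leqS m P : cnt m P <= cnt m.+1 P.
Proof. by rewrite /cnt big_nat_recr //= leq_addr. Qed.

Lemma cntW m k P : m <= k -> cnt m P <= cnt k P.
Proof.
move=> /subnK <-; elim: (k - m) => // n IH.
by rewrite addSn (leq_trans IH) // cnt_leqS.
Qed.

Lemma cnt_leS m P Q : (forall i, i < m -> P i -> (0 < i) && Q i.-1) ->
  cnt m P <= cnt m Q.
Proof.
case: m => [|m] PQ; first by rewrite /cnt !big_geq.
apply: leq_trans (cnt_leqS _ _); rewrite /cnt big_nat_recl //.
case: (boolP (P 0)) => [/(PQ _ (ltn0Sn _))//|_]; rewrite add0n.
rewrite big_nat [leqRHS]big_nat; apply: leq_sum => i /andP[_ im].
by case: (boolP (P i.+1)) => // /(PQ i.+1 im) /= ->.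
Qed.

(** Ascents and descents of [P] alternate, so their numbers differ only by the values of [P] at the
    two ends. *)
Lemma cnt_descents m P :
  cnt m (fun k => P k && ~~ P k.+1) + P m =
  cnt m (fun k => ~~ P k && P k.+1) + P 0.
Proof.
elim: m => [|m IH]; first by rewrite /cnt !big_geq.
move: IH; rewrite /cnt !big_nat_recr //=.
by case: (P m); case: (P m.+1) => /=; lia.
Qed.

Lemma cnt_split m P p : p <= m ->
  cnt m P = cnt p P + cnt (m - p) (fun i => P (i + p)).
Proof.
move=> pm; rewrite /cnt (big_cat_nat (n := p)) //=; congr (_ + _).
by rewrite -{1}(add0n p) big_addn.
Qed.

End CountingPositions.

(* The positions on a longest path whose vertex set spans no cycle: M is the
   adjacency relation between positions, g the set of positions not adjacent to
   the last one, and I the first ends of the paths obtained by one rotation. *)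
Lemma rotation_count m N t (M : rel nat) (g : pred nat) :
  symmetric M -> irreflexive M -> m <= N -> 10 * t + 20 <= N ->
  let I j := (j.+1 < m) && M 0 j.+1 in
  N <= 2 * cnt m (predC g) + t -> N <= 2 * cnt m (M 0) + t ->
  (forall i, I i -> N <= 2 * cnt m (M i) + t) ->
  (forall i, I i -> g i) ->
  (forall i j, I i -> j < i -> M i j -> g j.+1) ->
  (forall i j, I i -> i.+1 < j -> j < m -> M i j -> g j.-1) ->
  exists Z : pred nat, [/\ N <= 2 * cnt m I + t, 2 * cnt m Z <= N + t &
    forall i, I i -> cnt m (predD (M i) Z) <= 5 * t + 5].
Proof.
move=> Ms Mi mN tN I hg h0 hI Ig F1 F2.
have cI : N <= 2 * cnt m I + t.
  apply: leq_trans h0 _; rewrite leq_add2r leq_mul2l /= .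
  by apply: cnt_leS => -[|i] im Mi0; rewrite ?Mi // in Mi0 *; rewrite /I im.
have cg : 2 * cnt m g <= N + t by have := cntC m g; lia.
have gI : cnt m (predD g I) <= t.
  have := cntID m g I; have -> : cnt m (predI g I) = cnt m I.
    apply/eqP; rewrite eqn_leq; apply/andP; split; apply: cnt_le => i im /=.
      by case/andP.
    by move=> Ii; rewrite Ii Ig.
  by lia.
(* After the rotation at [i] the path starts at [i], and the predecessor of j on it is j + 1 if j <
   i and j - 1 if j > i + 1. A crossing being excluded, that predecessor lies in [g]. Hence [h i]
   contains the neighbours of [i], and by counting it exceeds them by at most t + 1. *)
pose h i j := if j < i then g j.+1 else
  if j == i then false else if j == i.+1 then true else g j.-1.
have Mh i j : I i -> j < m -> M i j -> h i j.
  move=> Ii jm Mij; rewrite /h; case: ltngtP => [ji|ij|ji]; first exact: F1 Mij.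
    by case: eqP => // nij; apply: F2 Mij => //; lia.
  by rewrite ji Mi in Mij.
have ch i : I i -> cnt m (h i) <= cnt m g + 1.
  move=> Ii; have im : i.+1 < m by case/andP: Ii.
  rewrite (@cnt_split m (h i) i.+2) // (@cnt_split m g i.+1) ?(ltnW im) //.
  rewrite addnAC leq_add //.
    have -> : cnt i.+2 (h i) = cnt i (h i) + 1.
      by rewrite 2!cntS /h ltnn ltnNge leqnSn /= eqxx gtn_eqF // eqxx addn0.
    rewrite leq_add2r.
    apply: cnt_leq_pos => k ki; by rewrite /h ki.
  have -> : m - i.+1 = (m - i.+2).+1 by lia.
  apply: leq_trans (cnt_leqS _ _); apply: cnt_le => k _.
  rewrite /h ltnNge (_ : i <= k + i.+2); last by lia.
  rewrite !gtn_eqF /=; try lia.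
  by rewrite addnS.
have err i : I i -> cnt m (predD (h i) (M i)) <= t.+1.
  move=> Ii; have := hI _ Ii; have := ch _ Ii; rewrite (cntID m (h i) (M i)).
  have -> : cnt m (predI (h i) (M i)) = cnt m (M i).
    apply/eqP; rewrite eqn_leq; apply/andP; split; apply: cnt_le => j jm /=.
      by case/andP.
    by move=> Mij; rewrite Mij Mh.
  by lia.
(* The position [p] is to leave t + 2 elements of [I] on each side, one more than the error t + 1
   allows: no vertex can be an exception to all elements of a side. *)
have Nt : t.+2 <= cnt m I by lia.
have [p /= pm pI] : exists2 p, p <= m & cnt p I = t.+2.
  have : exists p, t.+2 <= cnt p I by exists m.
  move/ex_minnP => [p hp minp]; exists p; first exact: minp.
  apply/eqP; rewrite eqn_leq hp andbT.
  case: p hp minp => [|p] hp minp; first by rewrite /cnt big_geq.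
  rewrite cntS.
  have : cnt p I < t.+2 by rewrite ltnNge; apply/negP => /minp; rewrite ltnn.
  by case: (I p); lia.
pose hi Q := cnt m (fun j => (p <= j) && Q j).
pose lo Q := cnt m (fun j => (j < p) && Q j).
have loI : lo I = t.+2.
  rewrite -pI /lo (cnt_split _ pm) [X in _ + X]big1 ?addn0 => [|i _].
    by apply: eq_big_nat => i /andP[_ ip]; rewrite ip.
  by rewrite ltnNge leq_addl.
have hiI : t.+2 <= hi I.
  have : cnt m I <= lo I + hi I.
    by apply: cnt_leU => i _ Ii; rewrite Ii !andbT; case: ltnP.
  by lia.
(* For i < j in [I], adjacency is predicted by [g j.-1] as seen from i and by [g i.+1] as seen from
   j. As [M] is symmetric, the two predictions may disagree only within the error, so across [p]
   they are mostly all true or mostly all false. *)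
have A0 i : I i -> i < p -> ~~ g i.+1 -> hi (predI I (fun j => g j.-1)) <= t.+1.
  move=> Ii ip gi; apply: leq_trans (err i Ii); apply: cnt_le => j jm.
  move=> /and3P[pj Ij gj] /=; have ij : i < j by apply: leq_trans pj.
  have jne : j != i.+1 by apply: contraNneq gi => <-; apply: Ig.
  rewrite {1}/h ltnNge (ltnW ij) /= gtn_eqF // (negPf jne) gj andbT.
  rewrite Ms; apply: contra gi => /(Mh _ _ Ij).
  by rewrite /h ij; apply; case/andP: Ii => /ltnW.
have B0 j : I j -> p <= j -> j < m -> ~~ g j.-1 ->
    lo (predI I (fun i => g i.+1)) <= t.+1.
  move=> Ij pj jm gj; apply: leq_trans (err j Ij); apply: cnt_le => i im.
  move=> /and3P[ip Ii gi] /=; have ij : i < j by apply: leq_trans pj.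
  have jne : j != i.+1 by apply: contraNneq gj => ->; apply: Ig.
  rewrite {1}/h ij gi andbT Ms; apply: contra gj => /(Mh _ _ Ii jm).
  by rewrite /h ltnNge (ltnW ij) /= gtn_eqF // (negPf jne).
have Im j : I j -> j < m by case/andP => /ltnW.
(* Predictions true: elements of [I], hence almost all of [g], have their neighbouring position
   towards [p] in [g]. So [g] rarely changes its value, its shifts hardly differ from it, and [Z] is
   [g]. The bound adds 3t + 3 ascents, 2t + 1 descents and the position i + 1. *)
have [caseA|] := pselect (forall i, I i -> i < p -> g i.+1).
  have loA : lo (predI I (fun i => g i.+1)) = t.+2.
    rewrite -loI; apply: eq_big_nat => i _ /=.
    case: ltnP => //= ip; case: (boolP (I i)) => //= Ii.
    by rewrite caseA.
  have caseB j : I j -> p <= j -> g j.-1.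
    move=> Ij pj; apply: contraT => /(B0 _ Ij pj (Im _ Ij)).
    by rewrite loA ltnn.
  pose asc k := ~~ g k && g k.+1; pose desc k := g k && ~~ g k.+1.
  have desc_lo : cnt p desc <= t.
    apply: leq_trans gI; apply: leq_trans (cntW _ pm).
    apply: cnt_le => k kp /andP[gk gk1]; rewrite /= gk andbT.
    by apply: contra gk1 => /caseA; apply.
  have asc_hi : cnt (m - p) (fun k => (k + p < m.-1) && asc (k + p)) <= t.
    have : cnt (m - p) (fun k => (k + p < m.-1) && asc (k + p)) <=
           cnt m (fun k => (k < m.-1) && ((p <= k) && asc k)).
      rewrite (@cnt_split m _ p) //; apply: leq_trans (leq_addl _ _).
      by apply: cnt_le => k _; rewrite leq_addl.
    move/leq_trans; apply; apply: leq_trans gI.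
    case: (m) Im => [|m'] Im; first by rewrite /cnt !big_geq.
    rewrite cntS ltnn addn0; apply: cnt_leq_pos => k km.
    rewrite km /= => /and3P[pk gk gk1]; rewrite gk1 andbT.
    apply: contra gk => Ik; have := caseB _ Ik; rewrite /=; apply; lia.
  have asc_hi' : cnt (m.-1 - p) (fun k => asc (k + p)) <= t.
    apply: leq_trans asc_hi; apply: leq_trans (cntW _ (_ : m.-1 - p <= _)).
      apply: cnt_le => k km ->; rewrite andbT; lia.
    lia.
  have desc_hi : cnt (m.-1 - p) (fun k => desc (k + p)) <= t.+1.
    have E : cnt (m.-1 - p) (fun k => desc (k + p)) + g (m.-1 - p + p) =
             cnt (m.-1 - p) (fun k => asc (k + p)) + g p.
      exact: (cnt_descents (m.-1 - p) (fun k => g (k + p))).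
    have : cnt (m.-1 - p) (fun k => asc (k + p)) <= t by [].
    by move: E; case: (g _); case: (g _); lia.
  have asc_lo : cnt p asc <= 2 * t + 3.
    have : cnt p asc <= cnt p.+1 (fun k => (k <= p) && g k).
      by apply: cnt_leq_pos => k kp /andP[_ ->]; rewrite andbT.
    move/leq_trans; apply.
    have : cnt p.+1 (fun k => (k <= p) && g k) <= cnt p g + 1.
      rewrite cntS; apply: leq_add; last by case: (_ && _).
      by apply: cnt_le => i _ /andP[].
    move/leq_trans; apply; rewrite (cntID p g I).
    have : cnt p (predD g I) <= t by apply: leq_trans gI; apply: cntW.
    have : cnt p (predI g I) <= cnt p I by apply: cnt_le => i _ /andP[].
    by rewrite pI; lia.
  exists g; split => // i Ii.
  have im : i.+1 < m by case/andP: Ii.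
  have : cnt m (predD (M i) g) <=
    cnt m (fun j => (j < m.-1) && asc j) + cnt m (fun j => (j < m.-1) && desc j) + 1.
    apply: (@leq_trans (cnt m (fun j => (j < m.-1) && asc j) +
       (cnt m (fun j => (0 < j) && ((j.-1 < m.-1) && desc j.-1)) + cnt m (pred1 i.+1)))).
      apply: leq_trans (leq_add (leqnn _) (_ : cnt m (fun j => ((0 < j) && ((j.-1 < m.-1) && desc j.-1)) || (j == i.+1)) <= _)); last first.
        by apply: cnt_leU.
      apply: cnt_leU => j jm /andP[gj Mij]; rewrite /asc /desc.
      have := Mh _ _ Ii jm Mij; rewrite /h; case: ltngtP => //.
        by move=> ji gj1; rewrite gj gj1 ltn_predRL (leq_ltn_trans ji (ltnW im)).
      move=> ij; case: eqP => [|jne gj1]; first by rewrite !orbT.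
      by case: j ij gj gj1 jne jm {Mij} => // j ij gj gj1 jne jm;
        rewrite /= gj gj1 (ltn_predRL j) jm orbT.
    rewrite addnA; apply: leq_add; last exact: cnt1.
    by rewrite leq_add2l; apply: cnt_leS => j jm /andP[-> ->].
  move/leq_trans; apply.
  have X Q : cnt m (fun j => (j < m.-1) && Q j) <= cnt p Q + cnt (m.-1 - p) (fun k => Q (k + p)).
    have [pm1|] := leqP p m.-1.
      rewrite -(@cnt_split m.-1) // (_ : m = m.-1.+1); last by lia.
      rewrite cntS ltnn addn0.
      by apply: cnt_le => k _ /andP[].
    move=> pm1; apply: leq_trans (leq_addr _ _).
    apply: leq_trans (cntW _ (_ : m <= p)); last by lia.
    by apply: cnt_le => k _ /andP[].
  have := X asc; have := X desc; lia.
move=> /existsNP[i0 /not_implyP[Ii0 /not_implyP[i0p /negP gi0]]].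
have b1 := A0 _ Ii0 i0p gi0.
have [j0 [Ij0 pj0 gj0]] : exists j, [/\ I j, p <= j & ~~ g j.-1].
  apply: contrapT => /forallNP no; move: b1; rewrite leqNgt => /negP; apply.
  apply: leq_trans hiI _; apply: cnt_le => j jm /andP[pj Ij] /=.
  rewrite pj Ij /=; apply: contraT => gj; by case: (no j).
have a1 := B0 _ Ij0 pj0 (Im _ Ij0) gj0.
(* Predictions false: [g] rarely contains two consecutive positions. A neighbour of i other than i +
   1 has a position of [g] next to it, so it rarely lies in [g] itself, and [Z] is the complement of
   [g]. *)
pose adj k := (k < m.-1) && (g k && g k.+1).
have cadj : cnt m adj <= 4 * t + 2.
  have lo1 : cnt m (fun k => (k < p) && adj k) <= t.+1 + t.
    apply: leq_trans (leq_add a1 gI); apply: cnt_leU => k km.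
    by move=> /and4P[kp _ gk gk1] /=; rewrite kp gk gk1 !andbT; case: (I k).
  have hi1 : cnt m (fun k => (p <= k) && adj k) <= t.+1 + t.
    apply: leq_trans (leq_add b1 gI).
    have m0 : m = m.-1.+1 by case/andP: Ii0; lia.
    have : cnt m (fun k => (p <= k) && adj k) <=
           cnt m (fun k => [&& 0 < k, p <= k, g k & g k.-1]).
      rewrite m0 cntS /= [adj m.-1]/adj ltnn andbF addn0.
      apply: cnt_leq_pos => k km /and4P[pk _ gk gk1] /=.
      by rewrite gk gk1 (leq_trans pk).
    move/leq_trans; apply; apply: cnt_leU => k _ /and4P[_ pk gk gk1] /=.
    by rewrite pk gk gk1 !andbT; case: (I k).
  have : cnt m adj <= (t.+1 + t) + (t.+1 + t).
    apply: leq_trans (leq_add lo1 hi1); apply: cnt_leU => k _ ->.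
    by rewrite !andbT; case: ltnP.
  by lia.
exists (predC g); split => //.
  have : cnt m I <= cnt m g by apply: cnt_le => i _; apply: Ig.
  by have := cntC m g; lia.
move=> i Ii; have im : i.+1 < m by case/andP: Ii.
have : cnt m (predD (M i) (predC g)) <= cnt m (fun j => (j < i) && adj j) +
   (cnt m (fun j => [&& 0 < j, i <= j.-1 & adj j.-1]) + cnt m (pred1 i.+1)).
  apply: leq_trans (leq_add (leqnn _) (_ : cnt m (fun j => [&& 0 < j, i <= j.-1 & adj j.-1] || (j == i.+1)) <= _)); last first.
    by apply: cnt_leU.
  apply: cnt_leU => j jm; rewrite /= negbK => /andP[gj Mij]; rewrite /adj.
  have := Mh _ _ Ii jm Mij; rewrite /h; case: ltngtP => //.
    by move=> ji gj1; rewrite gj gj1 ltn_predRL (leq_ltn_trans ji (ltnW im)).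
  move=> ij; case: eqP => [|jne gj1]; first by rewrite !orbT.
  by case: j ij gj gj1 jne jm {Mij} => // j ij gj gj1 jne jm;
    rewrite /= gj gj1 (ltn_predRL j) jm -[i <= j]ltnS ij ?orbT.
move/leq_trans; apply.
have e1 : cnt m (fun j => [&& 0 < j, i <= j.-1 & adj j.-1]) <=
    cnt m (fun j => (i <= j) && adj j).
  by apply: cnt_leS => j _ /and3P[-> -> ->].
have := cnt1 m i.+1.
have : cnt m (fun j => (j < i) && adj j) + cnt m (fun j => (i <= j) && adj j)
   = cnt m adj.
  rewrite /cnt -big_split /=; apply: eq_bigr => j _.
  by case: ltnP; case: (adj j).
by lia.
Qed.

Section Rotation.
Variables (T : finType) (e : rel T).
Hypotheses (es : symmetric e) (ei : irreflexive e).

Lemma eq_cnt m (P Q : pred nat) : (forall i, i < m -> P i = Q i) ->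
  cnt m P = cnt m Q.
Proof. by move=> PQ; apply: eq_big_nat => i /andP[_ /PQ->]. Qed.

Lemma cnt_nth (x0 : T) (s : seq T) (P : pred T) : uniq s ->
  cnt (size s) (fun j => P (nth x0 s j)) = #|[set x in s | P x]|.
Proof.
move=> us; rewrite /cnt -(big_nth x0 predT (fun z => nat_of_bool (P z))).
rewrite big_uniq //= -sum1_card big_mkcond [RHS]big_mkcond /=.
by apply: eq_bigr => z _; rewrite !inE; case: (P z); case: (z \in s).
Qed.

Lemma cnt_index (x0 : T) (s : seq T) (P : pred nat) : uniq s ->
  cnt (size s) P = #|[set x in s | P (index x s)]|.
Proof.
move=> us; rewrite -(cnt_nth x0 (fun x => P (index x s)) us).
by apply: eq_cnt => i im; rewrite index_uniq.
Qed.

Definition rotate (i : nat) (s : seq T) := rev (take i.+1 s) ++ drop i.+1 s.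

Lemma perm_rotate i s : perm_eq (rotate i s) s.
Proof. by rewrite -{2}(cat_take_drop i.+1 s) perm_cat2r perm_rev. Qed.

Lemma nth_rotate x0 i j s : i < size s ->
  nth x0 (rotate i s) j = if j <= i then nth x0 s (i - j) else nth x0 s j.
Proof.
move=> im; rewrite nth_cat size_rev size_takel // ltnS.
case: leqP => ji; last by rewrite nth_drop subnKC.
by rewrite nth_rev ?size_takel // nth_take ?subSS // ltnS leq_subr.
Qed.

Lemma last_rotate x0 i s : i.+1 < size s -> last x0 (rotate i s) = last x0 s.
Proof.
move=> im; rewrite last_cat -{3}(cat_take_drop i.+1 s) last_cat.
by rewrite (drop_nth x0).
Qed.

Lemma sorted_rotate x0 i s : i.+1 < size s -> sorted e s ->
  e (nth x0 s 0) (nth x0 s i.+1) -> sorted e (rotate i s).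
Proof.
move=> im ss e0; have im' := ltnW im.
rewrite /rotate (take_nth x0 im') rev_rcons /= cat_path; apply/andP; split.
  have : sorted e (rev (take i.+1 s)).
    rewrite rev_sorted (eq_sorted (e' := e)); first exact: take_sorted.
    by move=> u v; rewrite es.
  by rewrite (take_nth x0 im') rev_rcons.
have -> : last (nth x0 s i) (rev (take i s)) = nth x0 s 0.
  case: s {ss e0 im'} im => // a s; case: i => //= i _.
  by rewrite rev_cons last_rcons.
by rewrite (drop_nth x0 im) /= e0; have := drop_sorted i.+1 ss;
  rewrite (drop_nth x0 im).
Qed.

(* As the vertices of I have about |S|/2 neighbours in S, their neighbourhoods
   are all almost equal to Z. *)
Lemma rotation (S : {set T}) t : 10 * t + 20 <= #|S| ->
  {in S, forall v, #|S| <= 2 * #|nbrs e v :&: S| + t} -> ~ ham e S ->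
  exists I Z : {set T}, [/\ I \subset S, #|S| <= 2 * #|I| + t,
    2 * #|Z| <= #|S| + t &
    {in I, forall v, #|(nbrs e v :&: S) :\: Z| <= 5 * t + 5}].
Proof.
move=> tS deg nham.
pose isp s := [/\ uniq s, sorted e s & {subset s <= S}].
have [s [[us ss sS] smax]] : exists s, isp s /\ forall s', isp s' -> size s' <= size s.
  pose P k := `[< exists2 s, isp s & size s = k >].
  have P0 : exists k, P k by exists 0; apply/asboolP; exists [::].
  have Pm k : P k -> k <= #|S|.
    move=> /asboolP[s [us _ sS] <-]; rewrite -(card_uniqP us).
    by apply: subset_leq_card; apply/subsetP.
  have := ex_maxnP P0 Pm; case=> k /asboolP[s sp <-] kmax.
  by exists s; split => // s' sp'; apply: kmax; apply/asboolP; exists s'.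
have [x0 x0S] : exists x0, x0 \in S.
  by apply/set0Pn; rewrite -card_gt0; lia.
have s0 : 0 < size s by apply: (smax [:: x0]); split => // z; rewrite inE => /eqP->.
have perm_isp s' : perm_eq s' s -> sorted e s' -> isp s'.
  by move=> ps ss'; split; rewrite ?(perm_uniq ps) // => z; rewrite (perm_mem ps) => /sS.
have end_nbr s' w : perm_eq s' s -> sorted e s' -> w \in S ->
    e (nth x0 s' 0) w -> w \in s.
  move=> ps ss' wS ew; apply: contraT => ws.
  suff : size (w :: s') <= size s by rewrite /= (perm_size ps) ltnn.
  have [u1 u2 u3] := perm_isp _ ps ss'.
  apply: smax; split.
  - by rewrite /= u1 (perm_mem ps) ws.
  - by case: (s') ss' ew (perm_size ps) => //= a q -> ; rewrite es => ->.
  - by move=> z; rewrite inE => /orP[/eqP->|/u3].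
(* If the longest path closes up to a cycle missing a vertex of S, its vertex set absorbs all
   neighbours in S, since a longest path can start at any vertex of the cycle. This set serves as
   both [I] and [Z]; it is not too large because a vertex of S outside it has all its neighbours in
   S outside it. *)
have [[c pc cc]|nocyc] := pselect (exists2 c, perm_eq c s & cycle e c).
  have [Ss|] := boolP (S \subset [set x in s]).
    case: nham; exists c; have cS : c =i S.
      move=> z; rewrite (perm_mem pc); apply/idP/idP => [/sS //|].
      by move=> /(subsetP Ss); rewrite inE.
    have uc : uniq c by rewrite (perm_uniq pc).
    split => //; rewrite -(card_uniqP uc) (eq_card cS); lia.
  move=> /subsetPn[w wS]; rewrite inE => ws.
  have clos v x : v \in s -> x \in S -> e v x -> x \in s.
    move=> vs xS evx; have [|i q ci] := @rot_to _ c v; first by rewrite (perm_mem pc).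
    apply: (@end_nbr (v :: q)) => //; first by rewrite -ci perm_rot.
    by move: cc; rewrite -(rot_cycle i) ci /= rcons_path => /andP[].
  exists [set x in s], [set x in s]; split.
  - by apply/subsetP => z; rewrite inE => /sS.
  - have vs : nth x0 s 0 \in s by apply: mem_nth.
    apply: leq_trans (deg _ (sS _ vs)) _; rewrite leq_add2r leq_mul2l /=.
    apply: subset_leq_card; apply/subsetP => z; rewrite !inE => /andP[ez zS].
    exact: clos ez.
  - have sub : [set x in s] \subset S by apply/subsetP => z; rewrite inE => /sS.
    have : #|nbrs e w :&: S| <= #|S :\: [set x in s]|.
      apply: subset_leq_card; apply/subsetP => z; rewrite !inE => /andP[ez zS].
      rewrite zS andbT; apply: contra ws => zs; apply: (clos z) => //.
      by rewrite es.
    have := deg _ wS; rewrite cardsD (setIidPr sub).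
    by have := subset_leq_card sub; lia.
  - move=> v; rewrite inE => vs; rewrite (_ : _ :\: _ = set0) ?cards0 //.
    apply/setP => z; rewrite !inE; apply/negbTE.
    by apply: contra_notN id _ => // /and3P[zs ez zS]; rewrite (clos v) in zs.
pose m := size s; pose v := nth x0 s; pose y := last x0 s.
have vS i : i < m -> v i \in S by move=> im; apply: sS; apply: mem_nth.
have cross r k : perm_eq r s -> sorted e r -> last x0 r = y -> k.+1 < m ->
    e (nth x0 r 0) (nth x0 r k.+1) -> ~~ e (nth x0 r k) y.
  move=> pr sr lr km e1; apply/negP => e2; apply: nocyc.
  have [||c pc cc] := @cycle_of_crossing_nth _ e r x0 k es sr _ e1.
  - by rewrite (perm_size pr).
  - by rewrite lr.
  by exists c => //; apply: perm_trans pc pr.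
pose M i j := e (v i) (v j); pose g j := ~~ e (v j) y.
pose I j := (j.+1 < m) && M 0 j.+1.
have cntE w : w \in S -> (forall z, z \in S -> e w z -> z \in s) ->
    cnt m (fun j => e w (v j)) = #|nbrs e w :&: S|.
  move=> wS wcl; rewrite cnt_nth //; apply: eq_card => z; rewrite !inE andbC.
  case ez: (e w z) => //=; apply/idP/idP => [/sS //|zS]; exact: wcl.
have nI i : I i -> forall z, z \in S -> e (v i) z -> z \in s.
  move=> /andP[im Mi] z zS ez; apply: (@end_nbr (rotate i s)) => //.
  - exact: perm_rotate.
  - exact: (@sorted_rotate x0).
  - by rewrite nth_rotate ?(ltnW im) // subn0.
have im' i : I i -> i < m by move=> /andP[/ltnW].
have rotI i k : I i -> k.+1 < m ->
    e (v i) (nth x0 (rotate i s) k.+1) -> ~~ e (nth x0 (rotate i s) k) y.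
  move=> Ii km ek; have /andP[im Mi] := Ii.
  apply: cross => //; first exact: perm_rotate.
  - exact: (@sorted_rotate x0).
  - by rewrite last_rotate.
  - by rewrite nth_rotate ?(ltnW im) // subn0.
have [||||||||||Z [cI cZ hZ]] := @rotation_count m #|S| t M g.
- by move=> i j; rewrite /M es.
- by move=> i; rewrite /M ei.
- rewrite /m -(card_uniqP us); apply: subset_leq_card; exact/subsetP.
- by [].
- have yS : y \in S.
    by rewrite /y -nth_last; apply: vS; rewrite /m; case: (size s) s0.
  rewrite (@eq_cnt _ _ (fun j => e y (v j))).
    rewrite cntE //; first exact: deg.
    move=> z zS ez; apply: (@end_nbr (rev s)) => //.
    - by rewrite perm_rev.
    - by rewrite rev_sorted (eq_sorted (e' := e)) // => a b; rewrite es.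
    - by rewrite nth_rev // subn1 nth_last.
  by move=> i _; rewrite /= /g negbK es.
- rewrite /M cntE; [exact/deg/vS|exact: vS|].
  by move=> z zS ez; apply: (@end_nbr s).
- move=> i Ii; rewrite /M cntE; [exact/deg/vS/im'|exact/vS/im'|exact: nI].
- by move=> i /andP[im Mi]; apply: (cross s).
- move=> i j Ii ji Mij.
  have := @rotI i (i - j).-1 Ii; rewrite prednK ?subn_gt0 //.
  rewrite !(nth_rotate x0 _ (im' _ Ii)) leq_subr (_ : (i - j).-1 <= i); last by lia.
  rewrite subKn ?(ltnW ji) // (_ : i - (i - j).-1 = j.+1); last by lia.
  by apply => //; have := im' _ Ii; lia.
- move=> i j Ii ij jm Mij.
  have := @rotI i j.-1 Ii; rewrite prednK; last by lia.
  rewrite !(nth_rotate x0 _ (im' _ Ii)).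
  have -> : (j <= i) = false by apply/negbTE; rewrite -ltnNge (ltnW ij).
  have -> : (j.-1 <= i) = false by apply/negbTE; rewrite -ltnNge ltn_predRL.
  by apply.
exists [set x in s | I (index x s)], [set x in s | Z (index x s)]; split.
- by apply/subsetP => z; rewrite inE => /andP[/sS].
- by rewrite -(cnt_index x0 I us).
- by rewrite -(cnt_index x0 Z us).
- move=> w; rewrite inE => /andP[ws Iw]; apply: leq_trans (hZ _ Iw).
  rewrite (cnt_index x0 _ us); apply: subset_leq_card; apply/subsetP => z.
  rewrite !inE => /and3P[zZ ewz zS].
  have wE : v (index w s) = w by rewrite /v nth_index.
  have zs : z \in s by apply: (nI _ Iw) => //; rewrite wE.
  by rewrite /= /M wE /v nth_index // ewz andbT zs; move: zZ; rewrite zs.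
Qed.

End Rotation.

(** * Applications of the closure *)

Section ClosureApplications.
Variable T : finType.
Implicit Types (e f A : rel T) (S U X K : {set T}) (p q s : seq T).

(** The condition [x != y] keeps the sum irreflexive although [clique_rel] and [star_rel] hold on
    the diagonal. *)
Definition addrel e A : rel T := fun x y => e x y || (x != y) && A x y.

Lemma addrel_sym e A : symmetric e -> symmetric A -> symmetric (addrel e A).
Proof. by move=> es As x y; rewrite /addrel es As eq_sym. Qed.

Lemma addrel_irr e A : irreflexive e -> irreflexive (addrel e A).
Proof. by move=> ei x; rewrite /addrel ei eqxx. Qed.

Lemma sub_addrel e A : subrel e (addrel e A).
Proof. by move=> x y exy; rewrite /addrel exy. Qed.

Lemma ham_addrel e A S : symmetric e -> irreflexive e -> symmetric A ->
  {in S &, forall u v, u != v -> A u v -> ~~ e u v ->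
     #|S| <= #|nbrs e u :&: S| + #|nbrs e v :&: S|} ->
  ham (addrel e A) S -> ham e S.
Proof.
move=> es ei As deg; apply: ham_closure => //.
- exact: addrel_sym.
- exact: addrel_irr.
- exact: sub_addrel.
- move=> u v uS vS; rewrite /addrel => + nuv; rewrite (negPf nuv) /=.
  by case/andP => uv Auv; apply: deg.
Qed.

Lemma nbrs_subset_card e S (D : {set T}) x :
  D \subset S -> {in D, forall y, e x y} -> #|D| <= #|nbrs e x :&: S|.
Proof.
move=> /subsetP DS De; apply: subset_leq_card; apply/subsetP => y yD.
by rewrite !inE De ?DS.
Qed.

Definition clique_rel K : rel T := fun x y => (x \in K) && (y \in K).
Definition star_rel K X : rel T := fun x y =>
  ((x \in K) && (y \in X)) || ((x \in X) && (y \in K)).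

Lemma clique_rel_sym K : symmetric (clique_rel K).
Proof. by move=> x y; rewrite /clique_rel andbC. Qed.

Lemma star_rel_sym K X : symmetric (star_rel K X).
Proof. by move=> x y; rewrite /star_rel orbC andbC [X in _ || X]andbC. Qed.

Lemma path_clique e X x p : {in X &, forall u v, u != v -> e u v} ->
  uniq (x :: p) -> {subset x :: p <= X} -> path e x p.
Proof.
move=> eX; elim: p x => //= y p IH x /andP[xp up] pX; rewrite IH //.
  by rewrite eX ?pX ?inE ?eqxx ?orbT //; apply: contraNneq xp => ->; rewrite inE eqxx.
by move=> u up'; apply: pX; rewrite inE up' orbT.
Qed.

(* A Hamiltonian path from p to q is a Hamiltonian cycle after adding a vertex z
   adjacent to p and q only, and the closure applies to the latter. *)
Lemma ham_path_dense e X K mu (p q z : T) : symmetric e -> irreflexive e ->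
  p \in X -> q \in X -> p != q -> z \notin X -> K \subset X ->
  {in K, forall k, #|X :\: nbrs e k| <= mu} -> 2 * mu + 1 <= #|X| ->
  {in X :\: K, forall x, #|X :\: K| + 2 <= #|nbrs e x :&: X|} ->
  2 * #|X :\: K| + 1 <= #|X| ->
  exists s, [/\ path e p s, last p s = q, uniq (p :: s) & p :: s =i X].
Proof.
move=> es ei pX qX pq zX KX hK hmu2 hX hXK.
pose B x := (x == p) || (x == q).
pose ez : rel T := fun x y => [|| [&& e x y, x \in X & y \in X],
  (x == z) && B y | (y == z) && B x].
have Bz : B z = false.
  by apply/negP => /orP[] /eqP zE; rewrite zE ?pX ?qX in zX.
have ezs : symmetric ez.
  move=> x y; rewrite /ez es; congr (_ || _); last by rewrite orbC.
  by congr (_ && _); rewrite andbC.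
have ezi : irreflexive ez.
  by move=> x; rewrite /ez ei /=; case: eqP => // ->; rewrite Bz.
pose S := z |: X.
have XS : X \subset S by apply: subsetUr.
have KS : K \subset S by apply: subset_trans XS.
have cS : #|S| = #|X|.+1 by rewrite /S cardsU1 zX.
have cK : #|X| = #|K| + #|X :\: K| by rewrite cardsD (setIidPr KX) subnKC // subset_leq_card.
(* Three layers of the closure. The vertices of K miss at most [mu] vertices each, so K becomes a
   clique. Its vertices then have degree at least |K| - 1, which together with |X - K| + 2 reaches
   |X| + 1 = |S|, so K is joined to all of X. Finally every vertex of X has K in its neighbourhood,
   K is more than half of X, and X becomes a clique. *)
pose e1 := addrel ez (clique_rel K).
pose e2 := addrel e1 (star_rel K X).
pose e3 := addrel e2 (clique_rel X).
have e1s : symmetric e1 by apply: addrel_sym => //; apply: clique_rel_sym.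
have e1i : irreflexive e1 by apply: addrel_irr.
have e2s : symmetric e2 by apply: addrel_sym => //; apply: star_rel_sym.
have e2i : irreflexive e2 by apply: addrel_irr.
have KP k : k \in K -> k \in X by move/(subsetP KX).
have degz x : x \in X -> #|nbrs e x :&: X| <= #|nbrs ez x :&: S|.
  move=> xX; apply: nbrs_subset_card => [|y].
    by apply: subset_trans XS; apply: subsetIr.
  by rewrite !inE /ez xX => /andP[-> ->].
have degK k : k \in K -> #|X| <= #|nbrs ez k :&: S| + mu.
  move=> kK; rewrite -(cardsID (nbrs e k) X) leq_add ?hK //.
  by rewrite setIC degz ?KP.
have ham3 : ham e3 S.
  exists [:: z, p & rcons (enum (X :\ p :\ q)) q].
  have e3X x y : x \in X -> y \in X -> x != y -> e3 x y.
    by move=> xX yX xy; rewrite /e3 /addrel xy /clique_rel xX yX orbT.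
  have ez3 : subrel ez e3.
    by move=> x y xy; do 3! apply: sub_addrel.
  have uq : uniq (p :: rcons (enum (X :\ p :\ q)) q).
    rewrite /= rcons_uniq mem_rcons inE !mem_enum !inE !eqxx /=.
    by rewrite andbF negb_or pq enum_uniq.
  have pqX : p :: rcons (enum (X :\ p :\ q)) q =i X.
    move=> y; rewrite inE mem_rcons inE mem_enum !inE.
    by case: eqP => [->|_] /=; [rewrite pX|case: eqP => [->|_] //=; rewrite qX].
  split.
  - by rewrite /= size_rcons.
  - rewrite (cycle_path z) /= last_rcons ez3 /=; last by rewrite /ez eqxx /B eqxx !orbT.
    rewrite ez3 /=; last by rewrite /ez eqxx /B eqxx orbT.
    by apply: (path_clique e3X uq) => y; rewrite pqX.
  - rewrite cons_uniq uq andbT pqX; exact: zX.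
  - by move=> y; rewrite inE pqX !inE.
have ham2 : ham e2 S.
  apply: ham_addrel ham3 => //; first exact: clique_rel_sym.
  move=> u v _ _ uv /andP[uX vX] nuv.
  have dK w : w \in X -> w \notin K -> #|K| <= #|nbrs e2 w :&: S|.
    move=> wX wK; apply: nbrs_subset_card => // y yK.
    rewrite /e2 /addrel /star_rel wX yK !orbT andbT orbC.
    by rewrite (_ : w != y) //; apply: contraNneq wK => ->.
  have nK w w' : w \in X -> w' \in X -> w != w' -> ~~ e2 w w' -> w \notin K.
    move=> wX wX' ww; apply: contra => wK.
    by rewrite /e2 /addrel /star_rel ww wK wX' orbT.
  have := dK u uX (nK _ _ uX vX uv nuv).
  have := dK v vX (nK _ _ vX uX _ _); rewrite eq_sym e2s cS => /(_ uv nuv).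
  by move: hXK cK; clear; lia.
have ham1 : ham e1 S.
  apply: ham_addrel ham2 => //; first exact: star_rel_sym.
  have deg1 k x : k \in K -> x \in X -> k != x -> ~~ e1 k x ->
      #|S| <= #|nbrs e1 k :&: S| + #|nbrs e1 x :&: S|.
    move=> kK xX kx nkx.
    have xK : x \notin K.
      by apply: contra nkx => xK; rewrite /e1 /addrel /clique_rel kx kK xK orbT.
    have dk : #|K| <= #|nbrs e1 k :&: S|.+1.
      rewrite (cardsD1 k) -[leqRHS]add1n leq_add ?leq_b1 //.
      apply: nbrs_subset_card => [|y].
        by apply: subset_trans KS; apply: subsetDl.
      rewrite !inE => /andP[yk yK].
      by rewrite /e1 /addrel /clique_rel kK yK eq_sym yk orbT.
    have dx : #|X :\: K| + 2 <= #|nbrs e1 x :&: S|.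
      apply: leq_trans (hX x _) _; first by rewrite inE xK.
      apply: leq_trans (degz _ xX) _; apply: subset_leq_card.
      by apply: setSI; apply/subsetP => y; rewrite !inE; apply: sub_addrel.
    by rewrite cS cK; move: dk dx; clear; lia.
  move=> u v _ _ uv /orP[] /andP[]; first by move=> *; apply: deg1.
  by move=> uX vK nuv; rewrite addnC deg1 // 1?eq_sym // e1s.
have [c [c3 cc uc cS']] : ham ez S.
  apply: ham_addrel ham1 => //; first exact: clique_rel_sym.
  move=> u v _ _ uv /andP[uK vK] _.
  by have := degK _ uK; have := degK _ vK; rewrite cS; move: hmu2; clear; lia.
have [|i r cr] := @rot_to _ c z; first by rewrite cS' !inE eqxx.
rewrite -(rot_cycle i) -(rot_uniq i) cr in cc uc.
have rX : r =i X.
  move=> y; have := cS' y; rewrite -(mem_rot i) cr !inE.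
  have zr : z \notin r by move: uc => /andP[].
  by case: eqP => // -> _; rewrite (negPf zX) (negPf zr).
have {uc} ur : uniq r by move: uc => /andP[].
have r2 : 1 < size r.
  rewrite -(card_uniqP ur) (eq_card rX) (cardsD1 p) pX (cardsD1 q) !inE.
  by rewrite eq_sym pq qX.
case: r {cr} cc ur rX r2 => // a r /=.
rewrite rcons_path => /and3P[za pr lz] /andP[ar ur] rX r2.
have Ba : B a.
  move: za; rewrite /ez eqxx Bz andbF (negPf zX) andbF /= orbF.
  by [].
have Bl : B (last a r).
  move: lz; rewrite /ez eqxx Bz andbF (negPf zX) !andbF /=.
  by [].
have pr' : path e a r.
  apply: sub_path_in pr => x y; rewrite !rX => xX yX.
  case/or3P => [/andP[]//|/andP[/eqP xz _]|/andP[/eqP yz _]].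
    by rewrite -xz xX in zX.
  by rewrite -yz yX in zX.
have la : last a r != a.
  by case: r {Bl lz pr pr' rX ur} ar r2 => //= b r ar _; apply: contraNneq ar => <-; apply: mem_last.
case/orP: Ba => /eqP aE; case/orP: Bl => /eqP lE.
- by rewrite lE aE eqxx in la.
- by exists r; rewrite -aE; split => //=; rewrite ar.
- exists (rev (belast a r)); have lr : p :: rev (belast a r) = rev (a :: r).
    by rewrite [a :: r]lastI rev_rcons lE.
  split.
  + by rewrite -lE rev_path; apply: sub_path pr' => x y; rewrite es.
  + have := congr1 (last p) lr; rewrite /= => ->.
    by rewrite rev_cons last_rcons.
  + by rewrite -[_ && _]/(uniq (p :: rev (belast a r))) lr rev_uniq /= ar.
  + by move=> x; rewrite lr mem_rev rX.
- by rewrite lE aE eqxx in la.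
Qed.

(* The segments s_1, ..., s_k are linked through vertices of the universal
   set: u_1 s_1 u_2 s_2 ... u_k s_k u_(k+1) ... *)
Lemma path_through_segments f S U (segs : seq (seq T)) u us :
  symmetric f -> U \subset S ->
  {in U & S, forall x y, x != y -> f x y} ->
  all (fun s => (s != [::]) && sorted f s) segs ->
  uniq (flatten segs ++ u :: us) -> {subset flatten segs <= S} ->
  {subset u :: us <= U} -> size segs <= size (u :: us) ->
  exists2 p, perm_eq (u :: p) (flatten segs ++ u :: us) & path f u p.
Proof.
move=> fs /subsetP US fU; elim: segs u us => [|s segs IH] u us /=.
  move=> _ /andP[uus uu] _ usU _; exists us => //.
  apply: (@path_clique f U) => //=; last by rewrite uus.
  by move=> x y xU yU; apply: fU => //; apply: US.
case: s => [|a s] //= /andP[ss asegs] /andP[ua uall] sS usU szs.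
have aS : a \in S by apply: sS; rewrite inE eqxx.
have sS' : {subset flatten segs <= S}.
  by move=> x xs; apply: sS; rewrite inE mem_cat xs !orbT.
have uU : u \in U by apply: usU; rewrite inE eqxx.
have fua : f u a.
  apply: fU => //; apply: contraNneq ua => <-.
  by rewrite !mem_cat !inE eqxx !orbT.
case: us usU szs ua uall => [|u' us] usU szs ua uall.
  case: segs {IH asegs sS'} szs sS ua uall => //= _ _ _ _.
  exists (a :: s); last by rewrite /= fua.
  by rewrite cats0 -cat1s perm_catC.
have u'U : u' \in U by apply: usU; rewrite !inE eqxx orbT.
have ls : last a s \in a :: s by apply: mem_last.
move: uall; rewrite cat_uniq [uniq (s ++ _)]cat_uniq => /and3P[/and3P[us1 _ us2] nh us3].
have us4 : uniq (flatten segs ++ u' :: us).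
  have us4 : uniq (u' :: us) by move: us3; rewrite cons_uniq => /andP[].
  rewrite cat_uniq us2 us4 andbT.
  apply: contra nh.
  case/hasP => x xu xs; apply/hasP; exists x; first by rewrite inE xu orbT.
  by rewrite /= mem_cat; apply/orP; right.
have usU' : {subset u' :: us <= U} by move=> x xs; apply: usU; rewrite inE xs orbT.
have [p pp pf] := IH u' us asegs us4 sS' usU' szs.
exists (a :: s ++ u' :: p).
  apply/permP => P; have := permP pp P; rewrite /= !(count_cat, cats0) /=.
  by clear; lia.
rewrite /= fua cat_path ss /= pf andbT fs; apply: fU => //.
  by apply: sS; rewrite -cat_cons mem_cat ls.
apply: contraNneq ua => lE; move: ls; rewrite -lE inE => /orP[/eqP<-|u's].
  by rewrite !mem_cat !inE eqxx !orbT.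
case/negP: nh; apply/hasP; exists u'; first by rewrite !inE eqxx orbT.
by rewrite /= mem_cat u's.
Qed.

(** U first becomes a clique and then universal; the strict inequality pays for u not being its own
    neighbour. Universal vertices then link the segments into a cycle, which needs at least as many
    of them as there are segments. *)
Lemma ham_of_segments e S U (segs : seq (seq T)) : symmetric e -> irreflexive e ->
  2 < #|S| -> U \subset S -> U != set0 ->
  {in U, forall u, #|S| <= 2 * #|nbrs e u :&: S|} ->
  {in U & S :\: U, forall u w,
     #|S| < #|U| + #|nbrs e u :&: (S :\: U)| + #|nbrs e w :&: S|} ->
  all (fun s => (s != [::]) && sorted e s) segs ->
  uniq (flatten segs) -> flatten segs =i S :\: U -> size segs <= #|U| ->
  ham e S.
Proof.
move=> es ei S3 US U0 degU degUW asegs usegs segsE szs.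
pose e1 := addrel e (clique_rel U); pose e2 := addrel e1 (star_rel U S).
have e1s : symmetric e1 by apply: addrel_sym => //; apply: clique_rel_sym.
have e1i : irreflexive e1 by apply: addrel_irr.
have e2s : symmetric e2 by apply: addrel_sym => //; apply: star_rel_sym.
have fU : {in U & S, forall x y, x != y -> e2 x y}.
  by move=> x y xU yS xy; rewrite /e2 /addrel /star_rel xy xU yS orbT.
have ham2 : ham e2 S.
  have uU : uniq (enum U) by apply: enum_uniq.
  have eU x : (x \in enum U) = (x \in U) by rewrite mem_enum.
  have sU : size (enum U) = #|U| by rewrite cardE.
  case: (enum U) uU eU sU => [|u us] uU eU sU.
    by case/set0Pn: U0 => x; rewrite -eU.
  have [|||||p pp pf] := @path_through_segments e2 S U segs u us e2s US fU.
  - apply: sub_all asegs => s /andP[-> /=]; apply: sub_sorted.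
    by move=> x y xy; do 2! apply: sub_addrel.
  - rewrite cat_uniq usegs uU andbT; apply/hasPn => x.
    by rewrite eU /= segsE inE => ->.
  - by move=> x; rewrite segsE inE => /andP[].
  - by move=> x; rewrite eU.
  - by rewrite sU.
  have pS : u :: p =i S.
    move=> x; rewrite (perm_mem pp) mem_cat segsE eU !inE.
    by case xU: (x \in U) => /=; rewrite ?(subsetP US x xU) ?orbF.
  have up : uniq (u :: p).
    rewrite (perm_uniq pp) cat_uniq usegs uU andbT; apply/hasPn => x.
    by rewrite eU /= segsE inE => ->.
  have szp : 2 < size (u :: p) by rewrite -(card_uniqP up) (eq_card pS).
  exists (u :: p); split => //.
  rewrite (cycle_path u) /= pf andbT e2s; apply: fU.
  - by rewrite -eU inE eqxx.
  - by rewrite -pS mem_last.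
  - case: p {pp pf pS} up szp => //= a p /andP[up _] _.
    by apply: contraNneq up => ->; apply: mem_last.
have ham1 : ham e1 S.
  apply: ham_addrel ham2 => //; first exact: star_rel_sym.
  have deg1 u w : u \in U -> w \in S -> u != w -> ~~ e1 u w ->
      #|S| <= #|nbrs e1 u :&: S| + #|nbrs e1 w :&: S|.
    move=> uU wS uw nuw.
    have wU : w \notin U.
      by apply: contra nuw => wU; rewrite /e1 /addrel /clique_rel uw uU wU orbT.
    have du : #|U| + #|nbrs e u :&: (S :\: U)| <= #|nbrs e1 u :&: S|.+1.
      rewrite (cardsD1 u) uU add1n addSn ltnS.
      rewrite -[leqRHS](cardsID U) leq_add //.
        apply: subset_leq_card; apply/subsetP => y; rewrite !inE => /andP[yu yU].
        rewrite yU (subsetP US) // !andbT /e1 /addrel /clique_rel uU yU.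
        by rewrite eq_sym yu orbT.
      apply: subset_leq_card; apply/subsetP => y; rewrite !inE => /and3P[ey yU yS].
      by rewrite yU yS andbT; apply: sub_addrel.
    have dw : #|nbrs e w :&: S| <= #|nbrs e1 w :&: S|.
      by apply/subset_leq_card/setSI/subsetP => y; rewrite !inE; apply: sub_addrel.
    have := degUW u w uU; rewrite inE wU wS => /(_ isT); move: du dw; clear; lia.
  move=> u v uS vS uv /orP[] /andP[uX vX] nuv; first exact: deg1.
  by rewrite addnC deg1 // 1?eq_sym // e1s.
apply: ham_addrel ham1 => //; first exact: clique_rel_sym.
move=> u v _ _ uv /andP[uU vU] _.
by have := degU _ uU; have := degU _ vU; clear; lia.
Qed.

End ClosureApplications.

(** * Structure of the extremal graphs *)

Section Structure.
Variables (T : finType) (e : rel T) (n : nat).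
Hypotheses (es : symmetric e) (ei : irreflexive e).
Hypotheses (cardT2 : #|T| = 2 * n) (reg : forall v, #|nbrs e v| = n.+1).
Implicit Types (A B F P Q S X Y Z : {set T}).

Lemma leq_cardU X Y Z : X \subset Y :|: Z -> #|X| <= #|Y| + #|Z|.
Proof. by move/subset_leq_card => /leq_trans; apply; rewrite cardsU leq_subr. Qed.

Lemma cardsDU X Y Z : #|X :\: Z| <= #|X :\: Y| + #|Y :\: Z|.
Proof.
apply: leq_cardU; apply/subsetP => x; rewrite !inE.
by case: (x \in Y); case: (x \in X); case: (x \in Z).
Qed.

Lemma double_count X Y (r : rel T) :
  \sum_(x in X) #|[set y in Y | r x y]| = \sum_(y in Y) #|[set x in X | r x y]|.
Proof.
have E (Z : {set T}) (q : pred T) : #|[set y in Z | q y]| = \sum_(y in Z) q y.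
  rewrite -sum1_card big_mkcond [RHS]big_mkcond /=; apply: eq_bigr => y _.
  by rewrite inE; case: (y \in Z); case: (q y).
rewrite (eq_bigr (fun x => \sum_(y in Y) r x y)) => [|x _]; last exact: E.
by rewrite exchange_big /=; apply: eq_bigr => y _; rewrite E.
Qed.

Lemma markov_card X (f : T -> nat) c m k : \sum_(x in X) f x <= m ->
  m <= c * k -> #|[set x in X | c < f x]| <= k.
Proof.
move=> fm mk; have: \sum_(x in [set x in X | c < f x]) c.+1 <= c * k.
  apply: leq_trans (leq_trans fm mk); rewrite big_mkcond [leqRHS]big_mkcond /=.
  by apply: leq_sum => x _; rewrite inE; case: (x \in X) => //=; case: ltnP.
rewrite sum_nat_const; case: (ltngtP k #|[set x in X | c < f x]|) => // ck.
by have := leq_mul (leqnn c.+1) ck; clear; lia.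
Qed.

Definition balanced (tau : nat) F S :=
  (#|F| <= 2 * #|F :&: S| + tau) && (2 * #|F :&: S| <= #|F| + tau).

(** By regularity the two one-sided differences of neighbourhoods have the same size, so bounding
    one of them suffices. *)
Definition twins K u : {set T} := [set v | #|nbrs e v :\: nbrs e u| <= K].

Lemma nonham_twins tau S : let K := 45 * tau + 20 in
  30 * tau + 20 <= n -> balanced tau setT S ->
  (forall v, balanced tau (nbrs e v) S) ->
  (forall v w, balanced tau (nbrs e v :\: nbrs e w) S) ->
  (forall u, balanced tau (twins K u) S) ->
  ~ ham e S -> exists u, n <= #|twins K u| + K.
Proof.
move=> K ntau /andP[bT1 bT2] bN bD bA nham.
rewrite setTI cardsT cardT2 in bT1 bT2.
have deg v : v \in S -> #|S| <= 2 * #|nbrs e v :&: S| + 2 * tau.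
  by move=> _; have /andP[+ _] := bN v; rewrite reg; lia.
have [|I [Z [IS cI cZ hZ]]] := @rotation T e es ei S (2 * tau) _ deg nham.
  lia.
(* Inside S the neighbourhood of v exceeds Z by at most 10 tau + 5, and Z exceeds that of w by at
   most 12 tau + 5. Balance turns 22 tau + 10 into twice as much plus tau in the whole graph, which
   is [K]. *)
have tw v w : v \in I -> w \in I -> #|nbrs e v :\: nbrs e w| <= K.
  move=> vI wI; have /andP[+ _] := bD v w.
  have : #|(nbrs e v :\: nbrs e w) :&: S| <=
      #|(nbrs e v :&: S) :\: Z| + #|Z :\: (nbrs e w :&: S)|.
    apply: leq_cardU; apply/subsetP => x; rewrite !inE.
    by case: (x \in Z); case: (x \in S); case: (e v x); case: (e w x).
  have := hZ _ vI; have := hZ _ wI; have := deg _ (subsetP IS _ wI).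
  have := cardsID (nbrs e w :&: S) Z; have := cardsID Z (nbrs e w :&: S).
  rewrite (setIC Z) /K; lia.
have [u uI] : exists u, u \in I by apply/set0Pn; rewrite -card_gt0; lia.
exists u; have /andP[_] := bA u.
have : #|I| <= #|twins K u :&: S|.
  apply: subset_leq_card; apply/subsetP => v vI.
  by rewrite !inE (subsetP IS) // andbT tw.
by rewrite /K; lia.
Qed.

(** The pattern of adjacency is left out, so that one record serves both alternatives and P and Q
    may be exchanged. The remaining vertices fit neither pattern, but they have enough neighbours in
    either part to be absorbed there. *)
Record near_extremal d P Q : Prop := NearExtremal {
  ne_disj : [disjoint P & Q];
  ne_rest : #|~: (P :|: Q)| <= 2 * d;
  ne_P : n <= #|P| + 2 * d;
  ne_Q : n <= #|Q| + 2 * d;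
  ne_restP : {in ~: (P :|: Q), forall y, 95 * d <= #|nbrs e y :&: P|};
  ne_restQ : {in ~: (P :|: Q), forall y, 95 * d <= #|nbrs e y :&: Q|} }.

(* With A the set of twins of u and B its neighbourhood, P is the set of vertices
   adjacent to almost all of A and Q the set of vertices adjacent to almost none
   of A. A twin of u lying in P shows that A and B almost coincide, which gives
   two cliques; if there are almost no such twins, then A and B are almost
   disjoint, which gives a bipartite graph. *)
Lemma twins_structure K d l u : 0 < d -> K <= d -> l <= d -> 400 * d <= n ->
  2 * n * K <= d * l -> n <= #|twins K u| + K ->
  exists P Q, near_extremal d P Q /\
   (({in P, forall p, #|P :\: nbrs e p| <= 107 * d} /\
     {in Q, forall q, #|Q :\: nbrs e q| <= 107 * d}) \/
    ({in P, forall p, #|Q :\: nbrs e p| <= 107 * d} /\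
     {in Q, forall q, #|P :\: nbrs e q| <= 107 * d})).
Proof.
move=> d0 Kd ld dn nK; set A := twins K u => hA; pose B := nbrs e u.
have cB : #|B| = n.+1 by apply: reg.
have cBC : #|~: B| = n.-1 by have := cardsC B; rewrite cB cardT2; lia.
have cA : #|A| <= 2 * n by rewrite -cardT2; apply: max_card.
have twA v : v \in A -> #|nbrs e v :\: B| <= K by rewrite inE.
have twA' v : v \in A -> #|B :\: nbrs e v| <= K.
  move=> /twA; have := cardsID B (nbrs e v); have := cardsID (nbrs e v) B.
  by rewrite reg cB setIC; lia.
have sumK : \sum_(x in A) K <= 2 * n * K by rewrite sum_nat_const leq_mul2r cA orbT.
(* Each twin misses at most K vertices of B and has at most K neighbours outside B. Summing over the
   twins and applying Markov's inequality, at most [l] vertices violate any threshold that is at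
   least [d]. *)
have sum1 : \sum_(w in B) #|A :\: nbrs e w| <= 2 * n * K.
  apply: leq_trans sumK.
  rewrite (eq_bigr (fun w => #|[set v in A | ~~ e w v]|)) => [|w _].
    rewrite double_count; apply: leq_sum => v vA.
    apply: leq_trans (twA' v vA); apply: subset_leq_card; apply/subsetP => x.
    by rewrite !inE (es x v) andbC.
  by apply: eq_card => x; rewrite !inE andbC.
have sum0 : \sum_(w in ~: B) #|A :&: nbrs e w| <= 2 * n * K.
  apply: leq_trans sumK.
  rewrite (eq_bigr (fun w => #|[set v in A | e w v]|)) => [|w _].
    rewrite double_count; apply: leq_sum => v vA.
    apply: leq_trans (twA v vA); apply: subset_leq_card; apply/subsetP => x.
    by rewrite !inE (es x v).
  by apply: eq_card => x; rewrite !inE.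
have nKD c : d <= c -> 2 * n * K <= c * l.
  by move=> dc; apply: leq_trans nK _; rewrite leq_mul2r dc orbT.
(* The threshold is far above the errors of order d made in replacing A by P or Q: after these
   losses 100 d becomes 95 d for the remaining vertices and 107 d in the bounds on missing
   neighbours. *)
pose D := 100 * d.
have dD : d <= D by rewrite /D; lia.
have cY1 := leq_trans (markov_card sum1 (nKD _ dD)) ld.
have cY0 := leq_trans (markov_card sum0 (nKD _ dD)) ld.
have cB0 := leq_trans (markov_card sum1 (nKD _ (leqnn d))) ld.
set Y1 := [set x in B | _ < _] in cY1; set Y0 := [set x in ~: B | _ < _] in cY0.
pose B1 := [set w | #|A :\: nbrs e w| <= D].
pose A1 := [set w | #|A :&: nbrs e w| <= D].
have sIA w : #|A :&: nbrs e w| + #|A :\: nbrs e w| = #|A| by apply: cardsID.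
have AB1 : [disjoint B1 & A1].
  rewrite -setI_eq0; apply/eqP/setP => w; rewrite !inE; apply/negP => /andP[].
  by have := sIA w; rewrite /D; lia.
set Y := ~: (B1 :|: A1).
have s1 : #|B :\: B1| <= d.
  apply: leq_trans cY1; apply: subset_leq_card; apply/subsetP => w.
  by rewrite !inE -ltnNge andbC.
have s2 : #|B1 :\: B| <= d.
  apply: leq_trans cY0; apply: subset_leq_card; apply/subsetP => w.
  rewrite !inE => /andP[-> /=]; have := sIA w; rewrite /D; lia.
have s3 : #|A1 :&: B| <= d.
  apply: leq_trans cY1; apply: subset_leq_card; apply/subsetP => w.
  rewrite !inE => /andP[+ -> /=]; have := sIA w; rewrite /D; lia.
have s4 : #|~: B :\: A1| <= d.
  apply: leq_trans cY0; apply: subset_leq_card; apply/subsetP => w.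
  by rewrite !inE -ltnNge andbC.
have cY : #|Y| <= 2 * d.
  have : #|Y| <= #|B :\: B1| + #|~: B :\: A1|.
    apply: leq_cardU; apply/subsetP => w; rewrite !inE negb_or => /andP[-> ->].
    by case: (e u w).
  by lia.
have cB1 : n <= #|B1| + d /\ #|B1| <= n + d + 1.
  have := cardsID B B1; have := cardsID B1 B; rewrite setIC; lia.
have cA1 : n <= #|A1| + d + 1 /\ #|A1| <= n + d.
  have := cardsID (~: B) A1; have := cardsID A1 (~: B).
  have -> : A1 :\: ~: B = A1 :&: B by rewrite setDE setCK.
  by rewrite setIC; lia.
have cY' w : w \in Y -> D < #|A :&: nbrs e w| /\ D < #|A :\: nbrs e w|.
  by rewrite !inE negb_or -!ltnNge => /andP[-> ->].
have cNA w : #|A :&: nbrs e w| + #|nbrs e w :\: A| = n.+1.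
  by rewrite -(reg w) -(cardsID A (nbrs e w)) [A :&: _]setIC.
have part X Z w : #|nbrs e w :\: A| <= #|nbrs e w :&: X| + (#|Z :\: A| + #|~: (X :|: Z)|).
  apply: leq_trans (_ : #|(nbrs e w :&: X) :|: ((Z :\: A) :|: ~: (X :|: Z))| <= _).
    apply: subset_leq_card; apply/subsetP => x; rewrite !inE => /andP[-> ->].
    by case: (x \in X); case: (x \in Z).
  by apply: leq_trans (leq_cardU (subxx _)) _; rewrite leq_add2l leq_cardU.
have part' X Z w : #|nbrs e w| <= #|nbrs e w :&: X| + (#|nbrs e w :&: Z| + #|~: (X :|: Z)|).
  apply: leq_trans (_ : #|(nbrs e w :&: X) :|: ((nbrs e w :&: Z) :|: ~: (X :|: Z))| <= _).
    apply: subset_leq_card; apply/subsetP => x; rewrite !inE => ->.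
    by case: (x \in X); case: (x \in Z).
  by apply: leq_trans (leq_cardU (subxx _)) _; rewrite leq_add2l leq_cardU.
have cAX X w : #|A :&: nbrs e w| <= #|nbrs e w :&: X| + #|A :\: X|.
  apply: leq_cardU; apply/subsetP => x; rewrite !inE => /andP[-> ->].
  by case: (x \in X).
have YC : ~: (A1 :|: B1) = Y by rewrite setUC.
exists B1, A1.
have [AB|AB] : #|A :\: B| <= 2 * d \/ #|A :&: B| <= d.
  set B0 := [set x in B | _ < _] in cB0.
  have [|[v]] := set_0Vmem (A :&: B :\: B0).
    move/eqP; rewrite setD_eq0 => /subset_leq_card ABB; right; lia.
  rewrite !inE -!/A => /andP[]; rewrite negb_and -!leqNgt => + /andP[vA vB].
  rewrite vB /= => vd; left.
  have := cardsDU A (nbrs e v) B; have := twA v; rewrite inE => /(_ vA); lia.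
- have a1 : #|A :\: B1| <= 3 * d by have := cardsDU A B B1; lia.
  have a2 : #|B1 :\: A| + #|A| <= n + 1 + 3 * d.
    have := cardsDU B1 B A; have := cardsID A B; have := cardsID B A.
    by rewrite setIC; lia.
  split; first split => //.
  + by lia.
  + by lia.
  + by move=> y yY; have := cY' y yY; have := cAX B1 y; rewrite /D; lia.
  + move=> y yY; have := cY' y yY; have := cNA y; have := part A1 B1 y.
    by have := sIA y; rewrite YC /D; lia.
  left; split=> w; rewrite inE => wd.
    by have := cardsDU B1 A (nbrs e w); rewrite /D in wd; lia.
  have := cNA w; have := part A1 B1 w; have := cardsID (nbrs e w) A1.
  by rewrite YC [A1 :&: _]setIC; rewrite /D in wd; lia.
have a1 : #|A :\: A1| <= 2 * d.
  have : #|A :\: A1| <= #|A :&: B| + #|~: B :\: A1|.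
    apply: leq_cardU; apply/subsetP => x; rewrite !inE => /andP[-> ->].
    by case: (e u x).
  by lia.
have a2 : #|A1 :\: A| + #|A| <= n + 3 * d.
  by have := cardsID A1 A; have := cardsID A A1; rewrite setIC; lia.
split; first split => //.
- by lia.
- by lia.
- move=> y yY; have := cY' y yY; have := cNA y; have := part B1 A1 y.
  by have := sIA y; rewrite -/Y /D; lia.
- by move=> y yY; have := cY' y yY; have := cAX A1 y; rewrite /D; lia.
right; split=> w; rewrite inE => wd.
  by have := cardsDU A1 A (nbrs e w); rewrite /D in wd; lia.
have := part' B1 A1 w; have := cardsID (nbrs e w) B1.
have : #|nbrs e w :&: A1| <= #|A :&: nbrs e w| + #|A1 :\: A|.
  apply: leq_cardU; apply/subsetP => x; rewrite !inE => /andP[-> ->].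
  by case: (_ <= K).
by rewrite reg -/Y [B1 :&: _]setIC; rewrite /D in wd; lia.
Qed.

End Structure.

Import Order.TTheory GRing.Theory Num.Theory.

(** * Random subsets *)

Section CentralBinomial.

(** The square of the bound 4^n / (2 sqrt n); it is inductive because (2n + 1)^2 is at least 4n(n +
    1). *)
Lemma central_binomial n : 0 < n -> 16 ^ n <= 'C(2 * n, n) ^ 2 * (4 * n).
Proof.
case: n => // n _; elim: n => [|n IH]; first by [].
have H1 : 'C(2 * n.+2, n.+2) * n.+2 = 'C(2 * n.+1, n.+1) * (2 * (2 * n.+1).+1).
  have -> : 2 * n.+2 = (2 * n.+1).+2 by lia.
  have /= E1 := mul_bin_diag (2 * n.+1).+2 n.+1.
  have /= E2 := mul_bin_down (2 * n.+1).+1 n.+1.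
  have E3 : (2 * n.+1).+1 - n.+1 = n.+2 by lia.
  rewrite mulnC -E1; move: E2; rewrite E3 => E2.
  have -> : (2 * n.+1).+2 = 2 * n.+2 by lia.
  by rewrite -mulnA -E2; lia.
have : 16 ^ n.+2 * n.+2 ^ 2 <= 'C(2 * n.+2, n.+2) ^ 2 * (4 * n.+2) * n.+2 ^ 2.
  rewrite mulnAC -expnMn H1 expnS.
  move: IH; set X := 16 ^ n.+1; set c := 'C(_, _); rewrite expnMn => IH.
  rewrite !expnS expn0; nia.
by rewrite leq_pmul2r // expn_gt0.
Qed.

(** The ratio of consecutive coefficients is (n - j) / (n + j + 1), and (n - (j + 1)^2)(n + j + 1)
    is at most (n - j^2)(n - j). *)
Lemma binomial_near_center n j : j <= n ->
  (n - j ^ 2) * 'C(2 * n, n) <= n * 'C(2 * n, n + j).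
Proof.
elim: j => [|j IH] jn; first by rewrite addn0 subn0.
have [nj|nj] := leqP n (j.+1 ^ 2).
  by rewrite (eqP nj) mul0n.
have := IH (ltnW jn).
have := mul_bin_left (2 * n) (n + j); rewrite -addnS.
have -> : 2 * n - (n + j) = n - j by lia.
set c := 'C(2 * n, n); set x := 'C(2 * n, n + j); set y := 'C(2 * n, n + j.+1).
move=> E H.
rewrite -(@leq_pmul2r (n + j.+1)); last by lia.
have : n * y * (n + j.+1) = (n - j) * (n * x) by rewrite -mulnA [y * _]mulnC E; lia.
move=> ->; apply: leq_trans (leq_mul (leqnn _) H).
rewrite mulnA mulnAC leq_mul2r; apply/orP; right.
move: nj; rewrite !expnS expn0 !muln1 => nj.
pose b := n - j.+1 * j.+1; have nE : n = b + j * j + (2 * j).+1 by rewrite /b; lia.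
have -> : n - j * j = b + (2 * j).+1 by lia.
have [d dE] : exists d, n = j + d by exists (n - j); lia.
have -> : n - j = d by lia.
have bd : b <= d by move: nE dE; clear; nia.
have -> : n + j.+1 = d + (2 * j).+1 by move: dE; clear; lia.
by rewrite -/b !mulnDr [d * b]mulnC leq_add2l leq_mul.
Qed.

End CentralBinomial.

Section RandomSubset.
Variable T : finType.
Implicit Types (F S X : {set T}).

Lemma card_sets : #|{set T}| = 2 ^ #|T|.
Proof.
rewrite -(cardsT T) -card_powerset; apply: eq_card => S.
by rewrite !inE subsetT.
Qed.

Lemma card_supersets F : #|[set S : {set T} | F \subset S]| * 2 ^ #|F| = 2 ^ #|T|.
Proof.
have -> : #|[set S : {set T} | F \subset S]| = 2 ^ #|~: F|.
  rewrite -card_powerset -(card_imset _ (@setC_inj T)); apply: eq_card => S.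
  rewrite !inE; apply/imsetP/idP => [[X XF ->]|SF].
    by rewrite setCS; rewrite inE in XF.
  by exists (~: S); rewrite ?setCK // inE -setCS setCK.
by rewrite -expnD addnC cardsC.
Qed.

(** The symmetric difference with F permutes the subsets. With F the complement of A, it turns the
    excess of S on A into the size of a uniform set, up to a constant. *)
Lemma card_preim_symdiff F (D : {set {set T}}) :
  #|[set S : {set T} | (S :\: F) :|: (F :\: S) \in D]| = #|D|.
Proof.
pose f S := (S :\: F) :|: (F :\: S).
have fK : involutive f.
  by move=> S; apply/setP => x; rewrite !inE; case: (x \in S); case: (x \in F).
rewrite -[RHS](card_imset _ (inv_inj fK)); apply: eq_card => S.
rewrite inE; apply/idP/imsetP => [SD|[X XD ->]]; first by exists (f S).
by rewrite -/(f (f X)) fK.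
Qed.

Lemma card_sets_size k : #|[set S : {set T} | #|S| == k]| = 'C(#|T|, k).
Proof.
by rewrite -cardsT -cards_draws; apply: eq_card => S; rewrite !inE subsetT.
Qed.

(** Anticoncentration, with r an integer bound for sqrt n. In the window each binomial coefficient
    is at least half the central one, which is at least 2^(2n) / (2r). *)
Lemma card_sets_near_half n r a b : #|T| = 2 * n -> 2 * b ^ 2 <= n -> n <= r ^ 2 ->
  a <= b -> 0 < n ->
  2 ^ #|T| * (b - a) <= #|[set S : {set T} | n + a <= #|S| < n + b]| * (4 * r).
Proof.
move=> cT bn nr ab n0.
have cE : #|[set S : {set T} | n + a <= #|S| < n + b]| =
    \sum_(n + a <= k < n + b) 'C(#|T|, k).
  transitivity (\sum_(S : {set T}) \sum_(n + a <= k < n + b | k == #|S|) 1).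
    rewrite -sum1_card big_mkcond /=; apply: eq_bigr => S _.
    by rewrite inE big_nat1_eq.
  rewrite (eq_bigr (fun S : {set T} => \sum_(n + a <= k < n + b) (k == #|S|))).
    rewrite exchange_big /=; apply: eq_bigr => k _; rewrite -card_sets_size.
    rewrite -sum1_card [RHS]big_mkcond /=; apply: eq_bigr => S _.
    by rewrite inE eq_sym; case: (_ == _).
  by move=> S _; rewrite big_mkcond /=; apply: eq_bigr => k _; case: (_ == _).
rewrite cE.
have : \sum_(n + a <= k < n + b) 'C(2 * n, n) <= \sum_(n + a <= k < n + b) 2 * 'C(#|T|, k).
  rewrite big_nat [leqRHS]big_nat; apply: leq_sum => k /andP[k1 k2].
  have [j jE] : exists j, k = n + j by exists (k - n); lia.
  have jb : j < b by lia.
  have := @binomial_near_center n j; rewrite -jE cT.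
  have : 2 * j ^ 2 <= n.
    by apply: leq_trans bn; rewrite leq_mul2l leq_exp2r //= ltnW.
  move=> h1 h2; have {}h2 := h2 (_ : j <= n).
  rewrite -(@leq_pmul2l n) //; apply: leq_trans (_ : 2 * (n - j ^ 2) * 'C(2 * n, n) <= _).
    by rewrite leq_mul2r; apply/orP; right; lia.
  by rewrite mulnCA -mulnA leq_mul2l h2 //; move: h1; rewrite expnS expn1; nia.
rewrite -big_distrr /= sum_nat_const_nat (_ : n + b - (n + a) = b - a); last by lia.
move=> H.
have hc : 2 ^ #|T| <= 'C(2 * n, n) * (2 * r).
  rewrite -(@leq_exp2r _ _ 2) // cT -expnM (_ : 2 * n * 2 = 4 * n); last by lia.
  rewrite expnM (_ : 2 ^ 4 = 16) //; apply: leq_trans (central_binomial n0) _.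
  by rewrite expnMn leq_mul2l expnMn leq_mul2l nr !orbT.
apply: leq_trans (leq_mul hc (leqnn _)) _.
by move: H; nia.
Qed.

Local Open Scope ring_scope.
Variable R : realType.

(** Only 1 + x <= exp x is used: it bounds the left side by 2 / (1 - l^2), hence by 2 (1 + 2 l^2) as
    l^2 <= 1/4. The weaker constant in the exponent does no harm. *)
Lemma expR_cosh_le (l : R) : `|l| <= 1 / 2 ->
  expR l + expR (- l) <= 2 * expR (2 * l ^+ 2).
Proof.
rewrite ler_norml => /andP[l1 l2].
have h1 := expR_ge1Dx (- l); have h2 := expR_ge1Dx l.
have h3 := expR_ge1Dx (2 * l ^+ 2); set x := l ^+ 2 in h3 *.
have p1 : 0 < 1 - l by lra.
have p2 : 0 < 1 + l by lra.
have e1 : expR l <= (1 - l)^-1.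
  by rewrite -[l in expR l]opprK expRN lef_pV2 ?posrE ?expR_gt0.
have e2 : expR (- l) <= (1 + l)^-1 by rewrite expRN lef_pV2 ?posrE ?expR_gt0.
apply: le_trans (lerD e1 e2) _.
have -> : (1 - l)^-1 + (1 + l)^-1 = 2 / (1 - x).
  by rewrite /x; field; rewrite -?expr2; apply/and3P; split; rewrite ?gt_eqF //; nra.
have x1 : x <= 1 / 4 by rewrite /x; nra.
have x0 : 0 <= x by rewrite /x; nra.
by rewrite ler_pdivrMr; nra.
Qed.

Lemma sum_expR_dev F (l : R) :
  \sum_(S : {set T}) expR (l * ((2 * #|F :&: S|)%:R - #|F|%:R)) =
  2 ^+ #|T| * ((expR l + expR (- l)) / 2) ^+ #|F|.
Proof.
pose w x := if x \in F then expR l else 1 : R.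
pose w' x := if x \in F then expR (- l) else 1 : R.
transitivity (\prod_x (w x + w' x)).
  rewrite bigA_distr; apply: eq_bigr => S _.
  transitivity (\prod_(x in F) (if x \in S then expR l else expR (- l))).
    rewrite [RHS](bigID (mem S)) /=.
    rewrite [X in _ = X * _](eq_bigr (fun=> expR l)) => [|x /andP[_ ->] //].
    rewrite [X in _ = _ * X](eq_bigr (fun=> expR (- l))) => [|x /andP[_ /negPf->] //].
    rewrite !prodr_const -!expRM_natl -expRD; congr (expR _).
    have -> : #|[pred i in F | i \in S]| = #|F :&: S| by apply: eq_card => x; rewrite !inE.
    have E : #|[pred i in F | i \notin S]| = #|F :\: S|.
      by apply: eq_card => x; rewrite !inE andbC.
    rewrite E -[in LHS](cardsID S F) natrM natrD; ring.
  rewrite big_mkcond /=; apply: eq_bigr => x _; rewrite /w /w'.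
  by case: (x \in F); case: (x \in S).
rewrite (bigID (mem F)) /=.
rewrite (eq_bigr (fun=> expR l + expR (- l))) => [|x xF]; last by rewrite /w /w' xF.
rewrite [X in _ * X](eq_bigr (fun=> 2)) => [|x /negPf xF]; last first.
  by rewrite /w /w' xF.
rewrite !prodr_const -(cardC (mem F)) exprD expr_div_n.
have -> : #|[predC mem F]| = #|[pred i | i \notin F]| by apply: eq_card.
field.
by rewrite expf_neq0 // pnatr_eq0.
Qed.

Lemma chernoff F (M tau : nat) : (#|F| <= M)%N -> (0 < M)%N -> (tau <= 2 * M)%N ->
  #|[set S : {set T} | ~~ balanced tau F S]|%:R <=
    2 * expR (- (tau%:R ^+ 2 / (8 * M%:R))) * 2 ^+ #|T| :> R.
Proof.
(* This value minimises the exponent [2 * l ^+ 2 * M - l * tau]; the bound on [tau] makes it at most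
   1/2. *)
move=> FM M0 tM; pose l : R := tau%:R / (4 * M%:R).
have M0' : 0 < M%:R :> R by rewrite ltr0n.
have tM' : tau%:R <= 2 * M%:R :> R by rewrite -natrM ler_nat.
have l0 : 0 <= l by rewrite /l divr_ge0 ?mulr_ge0 ?ler0n.
have l1 : l <= 1 / 2 by rewrite /l ler_pdivrMr; lra.
pose dev S : R := (2 * #|F :&: S|)%:R - #|F|%:R.
have tail (s : R) : s ^+ 2 = 1 ->
    #|[set S : {set T} | tau%:R < s * dev S]|%:R <=
    expR (- (tau%:R ^+ 2 / (8 * M%:R))) * 2 ^+ #|T| :> R.
  move=> s1; set D := [set S : {set T} | _].
  have low : #|D|%:R * expR (l * tau%:R) <= \sum_(S : {set T}) expR (l * s * dev S).
    rewrite mulr_natl -sumr_const [leLHS]big_mkcond /=; apply: ler_sum => S _.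
    rewrite inE; case: ifP => [h|_]; last exact/ltW/expR_gt0.
    by rewrite ler_expR -mulrA ler_wpM2l // ltW.
  have sl : `|l * s| <= 1 / 2.
    have -> : `|l * s| = l; last by [].
    rewrite normrM (ger0_norm l0); suff -> : `|s| = 1 by rewrite mulr1.
    by apply/eqP; rewrite -(@eqrXn2 _ 2) // ?expr1n ?real_normK ?s1 ?num_real.
  have hi : \sum_(S : {set T}) expR (l * s * dev S) <=
      2 ^+ #|T| * expR (2 * l ^+ 2 * M%:R).
    rewrite sum_expR_dev ler_wpM2l ?exprn_ge0 //.
    apply: (@le_trans _ _ (expR (2 * l ^+ 2) ^+ #|F|)).
      rewrite lerXn2r ?nnegrE ?divr_ge0 ?addr_ge0 ?expR_ge0 //.
      have -> : l ^+ 2 = (l * s) ^+ 2 by rewrite [RHS]exprMn s1 mulr1.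
      by rewrite ler_pdivrMr // [leRHS]mulrC expR_cosh_le.
    rewrite -expRM_natr ler_expR ler_wpM2l ?ler_nat //.
    by rewrite mulr_ge0 ?exprn_ge0.
  have := le_trans low hi; rewrite -ler_pdivlMr ?expR_gt0 // -[_ * _ / _]mulrA -expRB => h.
  apply: le_trans h _; rewrite mulrC ler_wpM2r ?exprn_ge0 // ler_expR /l.
  by rewrite le_eqVlt; apply/orP; left; apply/eqP; field; rewrite gt_eqF.
apply: (@le_trans _ _ (#|[set S : {set T} | (tau%:R < (-1) * dev S)%R]|%:R +
                       #|[set S : {set T} | (tau%:R < 1 * dev S)%R]|%:R)).
  rewrite -natrD ler_nat; apply: leq_cardU; apply/subsetP => S.
  rewrite !inE negb_and -!ltnNge mulN1r mul1r /dev opprB => /orP[h|h].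
    by apply/orP; left; rewrite ltrBrDl -natrD ltr_nat.
  by apply/orP; right; rewrite ltrBrDl -natrD ltr_nat.
apply: le_trans (lerD (tail (-1) _) (tail 1 _)) _; rewrite ?sqrrN ?expr1n //.
by rewrite -[2 * _ * _]mulrA [2 * (_ * _)]mulr_natl mulr2n.
Qed.

End RandomSubset.

(** * Hamiltonian cycles in the extremal cases *)

Section ExtremalCases.
Variables (T : finType) (e : rel T) (n : nat).
Hypotheses (es : symmetric e) (ei : irreflexive e).
Hypotheses (cardT2 : #|T| = 2 * n) (reg : forall v, #|nbrs e v| = n.+1).
Implicit Types (A B P Q S U W X Y Z : {set T}).

Lemma near_extremal_sym d P Q : near_extremal e n d P Q -> near_extremal e n d Q P.
Proof.
case=> h1 h2 h3 h4 h5 h6; split; rewrite 1?disjoint_sym // 1?setUC //.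
Qed.

(** The vertices outside P and Q join the side of P: there are at most 2d of them, and each keeps
    about half of its 95 d neighbours in P. A path from x1 to x2 covers S outside Q, a path from q2
    to q1 covers S in Q, and the two crossing edges close them up. *)
Lemma ham_two_cliques d tau P Q S x1 x2 q1 q2 : near_extremal e n d P Q ->
  {in P, forall p, #|P :\: nbrs e p| <= 107 * d} ->
  {in Q, forall q, #|Q :\: nbrs e q| <= 107 * d} ->
  0 < d -> tau <= d -> 1000 * d <= n ->
  balanced tau P S -> balanced tau Q S ->
  (forall y, balanced tau (nbrs e y :&: P) S) ->
  x1 \notin Q -> x2 \notin Q -> q1 \in Q -> q2 \in Q -> x1 != x2 -> q1 != q2 ->
  e x1 q1 -> e x2 q2 -> [set x1; x2; q1; q2] \subset S -> ham e S.
Proof.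
case=> dPQ cY cP cQ hYP hYQ hP hQ d0 td dn /andP[bP _] /andP[bQ _] bN.
move=> x1Q x2Q q1Q q2Q x12 q12 e1 e2 sub.
have [x1S x2S q1S q2S] : [/\ x1 \in S, x2 \in S, q1 \in S & q2 \in S].
  by split; apply: (subsetP sub); rewrite !inE eqxx ?orbT.
pose X := S :\: Q; pose K := P :&: S.
have PQ x : x \in P -> x \notin Q by move=> xP; rewrite (disjointFr dPQ).
have KX : K \subset X.
  by apply/subsetP => x; rewrite !inE => /andP[xP ->]; rewrite PQ.
have XKY : X :\: K \subset ~: (P :|: Q).
  apply/subsetP => x; rewrite !inE => /and3P[nK nQ xS].
  by move: nK; rewrite xS andbT negb_or nQ andbT.
have cXK : #|X :\: K| <= 2 * d by apply: leq_trans (subset_leq_card XKY) cY.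
have cX : #|K| <= #|X| by apply: subset_leq_card.
have [s1 [p1 l1 u1 sX]] : exists s, [/\ path e x1 s, last x1 s = x2,
    uniq (x1 :: s) & x1 :: s =i X].
  (* A vertex of K misses 107 d vertices of P and at most 2d others. The vertex q1 is merely a point
     outside X. *)
  apply: (@ham_path_dense _ e X K (109 * d) x1 x2 q1) => //.
  - by rewrite inE x1Q.
  - by rewrite inE x2Q.
  - by rewrite inE q1Q.
  - move=> k; rewrite inE => /andP[kP kS].
    have : #|X :\: nbrs e k| <= #|P :\: nbrs e k| + #|X :\: K|.
      apply: leq_cardU; apply/subsetP => x; rewrite !inE => /and3P[-> -> ->].
      by case: (x \in P).
    by have := hP _ kP; move: cXK; clear; lia.
  - by move: bP cP cX td dn; rewrite -/K; clear -d0; lia.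
  - move=> y yXK; have yY := subsetP XKY _ yXK.
    have : #|(nbrs e y :&: P) :&: S| <= #|nbrs e y :&: X|.
      apply: subset_leq_card; apply/subsetP => x; rewrite !inE => /andP[/andP[-> xP] ->].
      by rewrite PQ.
    have := hYP _ yY; have /andP[+ _] := bN y.
    by move: cXK td; clear -d0; lia.
  - by move: bP cP cX cXK td dn; rewrite -/K; clear -d0; lia.
have [s2 [p2 l2 u2 sQ]] : exists s, [/\ path e q2 s, last q2 s = q1,
    uniq (q2 :: s) & q2 :: s =i Q :&: S].
  apply: (@ham_path_dense _ e (Q :&: S) (Q :&: S) (107 * d) q2 q1 x1) => //.
  - by rewrite inE q2Q.
  - by rewrite inE q1Q.
  - by rewrite eq_sym.
  - by rewrite inE negb_and x1Q.
  - move=> q; rewrite inE => /andP[qQ _]; apply: leq_trans (hQ _ qQ).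
    by apply/subset_leq_card/setSD/subsetIl.
  - by move: bQ cQ td dn; clear -d0; lia.
  - by move=> x; rewrite setDv inE.
  - by rewrite setDv cards0; move: bQ cQ td dn; clear -d0; lia.
have SE : (x1 :: s1) ++ (q2 :: s2) =i S.
  by move=> x; rewrite mem_cat sX sQ !inE; case: (x \in Q); rewrite ?orbF.
have US : uniq ((x1 :: s1) ++ (q2 :: s2)).
  rewrite cat_uniq u1 u2 andbT; apply/hasPn => x.
  by rewrite sQ /= sX !inE => /andP[-> _].
exists ((x1 :: s1) ++ (q2 :: s2)); split => //.
  rewrite -(card_uniqP US) (eq_card SE).
  by have := subset_leq_card KX; have := subset_leq_card (subsetIr P S);
    move: bP cP td dn; clear -d0; lia.
by rewrite /= rcons_cat cat_path p1 l1 /= e2 rcons_path p2 l2 /= es e1.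
Qed.

(** Two vertices outside Q with two neighbours each in Q suffice. Two vertices of the rest will do.
    If the rest has at most one vertex and P is not larger than Q, a vertex of P has at most n - 1
    neighbours outside Q, so two of its n + 1 neighbours are in Q. *)
Lemma two_crossing_edges d P Q : near_extremal e n d P Q -> 0 < d -> 4 * d < n ->
  #|P| <= #|Q| \/ 2 <= #|~: (P :|: Q)| ->
  exists x1 x2 q1 q2, [/\ x1 != x2, q1 != q2, e x1 q1 & e x2 q2] /\
    [/\ x1 \notin Q, x2 \notin Q, q1 \in Q & q2 \in Q].
Proof.
case=> dPQ cY cP cQ hYP hYQ d0 dn hPQ; set Y := ~: (P :|: Q) in hPQ cY *.
have PQ x : x \in P -> x \notin Q by move=> xP; rewrite (disjointFr dPQ).
suff [x1 [x2 [x12 x1Q x2Q h1 h2]]] : exists x1 x2, [/\ x1 != x2, x1 \notin Q,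
    x2 \notin Q, 1 < #|nbrs e x1 :&: Q| & 1 < #|nbrs e x2 :&: Q|].
  have [q1] : exists q, q \in nbrs e x1 :&: Q.
    by apply/set0Pn; rewrite -card_gt0 ltnW.
  rewrite !inE => /andP[e1 q1Q].
  have [q2] : exists q, q \in (nbrs e x2 :&: Q) :\ q1.
    apply/set0Pn; rewrite -card_gt0; have := cardsD1 q1 (nbrs e x2 :&: Q).
    by move: h2; case: (q1 \in _); clear; lia.
  rewrite !inE => /and3P[q12 e2 q2Q].
  by exists x1, x2, q1, q2; split; split; rewrite 1?[q1 == _]eq_sym.
have two (X : {set T}) : 1 < #|X| -> exists x1 x2, [/\ x1 != x2, x1 \in X & x2 \in X].
  by case/card_gt1P => x1 [x2 [? ? ?]]; exists x1, x2.
have [Y2|Y1] := leqP 2 #|Y|.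
  have [x1 [x2 [x12 x1Y x2Y]]] := two _ Y2; exists x1, x2; split => //.
  - by move: x1Y; rewrite !inE negb_or => /andP[].
  - by move: x2Y; rewrite !inE negb_or => /andP[].
  - by apply: leq_trans (hYQ _ x1Y); lia.
  - by apply: leq_trans (hYQ _ x2Y); lia.
case: hPQ => [hPQ|]; last by rewrite leqNgt Y1.
have cE : #|P| + #|Q| + #|Y| = 2 * n.
  rewrite -cardT2 -(cardsC (P :|: Q)); congr (_ + _).
  by rewrite cardsU (disjoint_setI0 dPQ) cards0 subn0.
have hP p : p \in P -> 1 < #|nbrs e p :&: Q|.
  move=> pP; have : #|nbrs e p| <= #|(P :\ p) :|: Y| + #|nbrs e p :&: Q|.
    apply: leq_cardU; apply/subsetP => x; rewrite !inE => ex; rewrite ex.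
    have -> : x != p by apply: contraTneq ex => ->; rewrite ei.
    by case: (x \in P); case: (x \in Q).
  have := leq_cardU (subxx ((P :\ p) :|: Y)); have := cardsD1 p P.
  by rewrite reg pP; move: cE hPQ Y1; clear; lia.
have [|x1 [x2 [x12 x1P x2P]]] := two P; first by move: cP dn; clear -d0; lia.
by exists x1, x2; split => //; [exact: PQ|exact: PQ|exact: hP|exact: hP].
Qed.

(** Greedy choice of a path a y b for each y, with [W] the vertices already in use; each star adds
    two vertices to [W]. *)
Lemma star_segments A (ys : seq T) W : uniq ys -> {in ys, forall y, y \notin A} ->
  {in ys, forall y, #|W| + 2 * size ys <= #|nbrs e y :&: A|} ->
  exists segs : seq (seq T), [/\ size segs = size ys,
    all (fun s => (s != [::]) && sorted e s) segs,
    uniq (flatten segs), size (flatten segs) = 3 * size ys &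
    forall x, x \in flatten segs -> (x \in ys) || (x \in A) && (x \notin W)] /\
    {subset ys <= flatten segs}.
Proof.
elim: ys W => [|y ys IH] W /=; first by move=> *; exists [::]; split => //; split.
move=> /andP[yys uys] nA deg.
have yA : y \notin A by apply: nA; rewrite inE eqxx.
have : 1 < #|(nbrs e y :&: A) :\: W|.
  have := deg y (mem_head _ _); have := cardsID W (nbrs e y :&: A).
  have := subset_leq_card (subsetIr (nbrs e y :&: A) W); clear; lia.
case/card_gt1P => a [b []]; rewrite !inE => /and3P[aW eya aA] /and3P[bW eyb bA] ab.
have [||segs [[szs asegs us szf incl] ysub]] := IH (W :|: [set a; b]) uys.
- by move=> z zy; apply: nA; rewrite inE zy orbT.
- move=> z zy; apply: leq_trans (deg z _); last by rewrite inE zy orbT.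
  have := leq_cardU (subxx (W :|: [set a; b])); rewrite cards2 ab; clear; lia.
exists ([:: a; y; b] :: segs).
have aF : a \notin flatten segs.
  apply/negP => /incl; rewrite !inE eqxx !orbT andbF orbF => ays.
  by have := nA a; rewrite inE ays orbT aA => /(_ isT).
have bF : b \notin flatten segs.
  apply/negP => /incl; rewrite !inE eqxx !orbT andbF orbF => ays.
  by have := nA b; rewrite inE ays orbT bA => /(_ isT).
have yF : y \notin flatten segs.
  by apply/negP => /incl; rewrite (negPf yys) (negPf yA).
have ay : a != y by apply: contraNneq yA => <-.
have by' : b != y by apply: contraNneq yA => <-.
split; first split.
- by rewrite /= szs.
- by rewrite /= asegs es eya eyb.
- by rewrite /= !inE !negb_or aF bF yF us ay ab eq_sym by'.
- by rewrite /= szf; clear; lia.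
- move=> x; rewrite /= !inE => /or4P[/eqP->|/eqP->|/eqP->|/incl].
  + by rewrite aA aW orbT.
  + by rewrite eqxx.
  + by rewrite bA bW orbT.
  + case/orP => [->|]; first by rewrite orbT.
    by rewrite !inE negb_or => /and3P[-> -> _]; rewrite orbT.
- move=> x; rewrite /= !inE => /orP[/eqP->|/ysub ->]; first by rewrite eqxx orbT.
  by rewrite !orbT.
Qed.

Definition pair_segs (M : seq (T * T)) := [seq [:: p.1; p.2] | p <- M].

Lemma size_flatten_pair_segs M : size (flatten (pair_segs M)) = 2 * size M.
Proof. by elim: M => //= p M ->; rewrite mulnS. Qed.

Lemma flatten_pair_segs_filter (a : pred (T * T)) M :
  subseq (flatten (pair_segs (filter a M))) (flatten (pair_segs M)).
Proof.
elim: M => // p M IH; rewrite [filter _ _]/=.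
case: (a p); first by rewrite /= !eqxx.
apply: (subseq_trans IH); apply: (@subseq_trans _ (p.2 :: flatten (pair_segs M))).
  exact: subseq_cons.
exact: (subseq_cons _ p.1).
Qed.

Definition matching A (M : seq (T * T)) :=
  [&& uniq (flatten (pair_segs M)), all (mem A) (flatten (pair_segs M)) &
      all (fun p => e p.1 p.2) M].

Definition surviving S (M : seq (T * T)) :=
  filter (fun p => (p.1 \in S) && (p.2 \in S)) M.

Lemma ham_near_bipartite A B M S : [disjoint A & B] -> matching A M ->
  2 < #|S| -> B :&: S != set0 ->
  {in B :&: S, forall b, #|S| <= 2 * #|nbrs e b :&: S|} ->
  {in B :&: S & S :\: B, forall b w,
     #|S| < #|B :&: S| + #|nbrs e b :&: (S :\: B)| + #|nbrs e w :&: S|} ->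
  {in S :\: (A :|: B), forall y,
     2 * size M + 2 * #|~: (A :|: B)| <= #|nbrs e y :&: (A :&: S)|} ->
  #|S :&: A| <= #|S :\: A| + size (surviving S M) -> ham e S.
Proof.
move=> dAB /and3P[uM /allP MA /allP eM] S3 B0 degB degBW degY cA.
set Y := ~: (A :|: B) in degY.
pose ys := enum (S :\: (A :|: B)); pose MS := pair_segs (surviving S M).
pose W : {set T} := [set x in flatten MS].
have uMS : uniq (flatten MS) by apply: subseq_uniq uM; apply: flatten_pair_segs_filter.
have MSE x : x \in flatten MS -> (x \in A) && (x \in S).
  move=> xM; have /= -> : mem A x.
    by apply: MA; apply: mem_subseq xM; apply: flatten_pair_segs_filter.
  case/flattenP: xM => s /mapP[p]; rewrite mem_filter => /andP[/andP[p1 p2] _] ->.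
  by rewrite !inE => /orP[] /eqP->.
have cMS : size (flatten MS) = 2 * size (surviving S M) by apply: size_flatten_pair_segs.
have cW : #|W| <= 2 * size M.
  rewrite cardsE; apply: leq_trans (card_size _) _.
  rewrite -size_flatten_pair_segs; apply: size_subseq.
  exact: flatten_pair_segs_filter.
have szy : size ys = #|S :\: (A :|: B)| by rewrite -cardE.
have szY : size ys <= #|Y|.
  by rewrite szy; apply/subset_leq_card/subsetP => x; rewrite !inE => /andP[].
have [|||segs [[szs asegs us szf incl] ysub]] := @star_segments (A :&: S) ys W.
- exact: enum_uniq.
- by move=> y; rewrite mem_enum !inE negb_or => /andP[/andP[/negPf-> _] _].
- move=> y; rewrite mem_enum => /degY; move: cW szY; clear; lia.
pose segs1 := segs ++ MS; pose R := (S :\: B) :\: [set x in flatten segs1].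
pose segs2 := segs1 ++ [seq [:: x] | x <- enum R].
have fs1 : flatten [seq [:: x] | x <- enum R] = enum R.
  by elim: (enum R) => //= x s ->.
have AB x : x \in A -> x \notin B by move=> xA; rewrite (disjointFr dAB).
have us1 : uniq (flatten segs1).
  rewrite flatten_cat cat_uniq us uMS andbT; apply/hasPn => x xM /=.
  apply/negP => /incl; rewrite mem_enum !inE xM andbF orbF.
  by have /andP[-> _] := MSE _ xM.
have sub1 x : x \in flatten segs1 -> x \in S :\: B.
  rewrite flatten_cat mem_cat => /orP[/incl|/MSE /andP[xA xS]]; last first.
    by rewrite inE xS AB.
  rewrite mem_enum !inE negb_or => /orP[/andP[/andP[_ ->] ->] //|].
  by case/andP => /andP[/AB -> ->].
apply: (@ham_of_segments _ e S (B :&: S) segs2) => //.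
- exact: subsetIr.
- move=> u w uB; rewrite setDIr setDv setU0 => wS; exact: degBW.
- rewrite !all_cat asegs; apply/andP; split; last first.
    by apply/allP => s /mapP[x _ ->].
  apply/allP => s /mapP[p]; rewrite mem_filter => /andP[_ pM] -> /=.
  by rewrite eM.
- rewrite flatten_cat cat_uniq us1 fs1 enum_uniq andbT; apply/hasPn => x.
  by rewrite mem_enum !inE => /andP[].
- move=> x; rewrite flatten_cat fs1 mem_cat mem_enum setDIr setDv setU0.
  rewrite [x \in R]inE [x \in [set _ in _]]inE.
  by case: (boolP (x \in flatten segs1)) => [/sub1 ->|].
- have cR : #|R| + size (flatten segs1) = #|S :\: B|.
    rewrite -(cardsID [set x in flatten segs1] (S :\: B)) addnC; congr (_ + _).
    rewrite -(card_uniqP us1); apply: eq_card => x; rewrite !inE.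
    case: (boolP (x \in flatten segs1)) => [/sub1|]; rewrite ?andbF //.
    by rewrite !inE => ->.
  rewrite /segs2 /segs1 !size_cat !size_map -cardE szs.
  move: cR; rewrite /segs1 flatten_cat size_cat szf cMS.
  have e1 : #|S :\: B| = #|S :&: A| + #|S :\: (A :|: B)|.
    rewrite -(cardsID A (S :\: B)); congr (_ + _); apply: eq_card => x; rewrite !inE.
      by case: (boolP (x \in A)) => [/AB ->|]; rewrite ?andbF ?andbT.
    by rewrite negb_or andbA.
  have e2 : #|S :\: A| = #|B :&: S| + #|S :\: (A :|: B)|.
    rewrite -(cardsID B (S :\: A)); congr (_ + _); apply: eq_card => x; rewrite !inE.
      by case: (boolP (x \in A)) => [/AB /negPf->|]; rewrite ?andbF //= andbC.
    by rewrite negb_or andbA; congr (_ && _); rewrite andbC.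
  by move: e1 e2 cA szy; clear; lia.
Qed.

End ExtremalCases.

(** * Partitions near a complete bipartite graph, and their inner edges *)

Section BipartiteConfiguration.
Variables (T : finType) (e : rel T) (n : nat).
Hypotheses (es : symmetric e) (ei : irreflexive e).
Hypotheses (cardT2 : #|T| = 2 * n) (reg : forall v, #|nbrs e v| = n.+1).
Implicit Types (A B P Q S W X Y Z : {set T}) (M : seq (T * T)).

Lemma sum_nbrs_sym A B :
  \sum_(v in A) #|nbrs e v :&: B| = \sum_(v in B) #|nbrs e v :&: A|.
Proof.
rewrite (eq_bigr (fun v => #|[set w in B | e v w]|)) => [|v _]; last first.
  by apply: eq_card => w; rewrite !inE andbC.
rewrite double_count; apply: eq_bigr => v _; apply: eq_card => w.
by rewrite !inE es andbC.
Qed.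

(** If a matching of k + 1 edges cannot be extended, its 2 (k + 1) ends meet every edge inside A,
    and the degree sum is at most twice 2 (k + 1) Delta. *)
Lemma exists_matching A (Delta k : nat) :
  {in A, forall v, #|nbrs e v :&: A| <= Delta} ->
  4 * k * Delta < \sum_(v in A) #|nbrs e v :&: A| ->
  exists2 M, matching e A M & size M = k.+1.
Proof.
move=> hD; elim: k => [|k IH] hk.
  have [v vA hv] : exists2 v, v \in A & 0 < #|nbrs e v :&: A|.
    move: hk; rewrite muln0 mul0n; apply: contraPP => no.
    rewrite big1 // => v vA; apply/eqP; rewrite -leqn0 leqNgt; apply/negP => h.
    by apply: no; exists v.
  move: hv; rewrite card_gt0 => /set0Pn[w]; rewrite !inE => /andP[evw wA].
  exists [:: (v, w)] => //; rewrite /matching /= inE vA wA evw !andbT.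
  by apply: contraTneq evw => ->; rewrite ei.
have [|M mM szM] := IH.
  by apply: leq_ltn_trans hk; rewrite leq_mul2r leq_mul2l leqnSn !orbT.
have /and3P[uM MA eM] := mM.
pose W : {set T} := [set x in flatten (pair_segs M)].
have cW : #|W| = 2 * k.+1.
  by rewrite cardsE (card_uniqP uM) size_flatten_pair_segs szM.
have WA : W \subset A by apply/subsetP => x; rewrite inE => /(allP MA).
have [[v [w [/andP[vA vW] /andP[wA wW] evw]]]|no] := pselect (exists v w,
   [/\ (v \in A) && (v \notin W), (w \in A) && (w \notin W) & e v w]).
  exists ((v, w) :: M); last by rewrite /= szM.
  rewrite !inE in vW wW.
  rewrite /matching /= inE negb_or vW wW uM vA wA evw MA eM !andbT.
  by apply: contraTneq evw => ->; rewrite ei.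
suff : \sum_(v in A) #|nbrs e v :&: A| <= 4 * k.+1 * Delta by rewrite leqNgt hk.
have hW : \sum_(v in W) #|nbrs e v :&: A| <= 2 * k.+1 * Delta.
  rewrite -cW -sum_nat_const; apply: leq_sum => v vW; apply: hD.
  exact: (subsetP WA).
have : \sum_(v in A) #|nbrs e v :&: A| <=
    \sum_(v in W) #|nbrs e v :&: A| + \sum_(v in A) #|nbrs e v :&: W|.
  rewrite (bigID (mem W)) /= (eq_bigl (mem W)) => [|v]; last first.
    by rewrite /=; case: (boolP (v \in W)) => [/(subsetP WA) ->|]; rewrite ?andbF.
  rewrite leq_add2l [leqRHS](bigID (mem W)) /=; apply: leq_trans (leq_addl _ _).
  apply: leq_sum => v /andP[vA vW]; apply: subset_leq_card; apply/subsetP => w.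
  rewrite !inE => /andP[evw wA]; rewrite evw /=; apply: contraT => wW; case: no.
  by exists v, w; rewrite vA vW wA evw; split => //; rewrite inE.
rewrite (sum_nbrs_sym A W); move: hW; clear; lia.
Qed.

(* A is the side of which S contains too many vertices: the excess
   |S :&: A| - |S :\: A| is to deviate from its mean |A| - n by an amount between
   q / 2 and q. The vertices of B become universal in the closure, a vertex y
   outside A and B is absorbed in a path a y a' with a and a' in A, and the edges
   of M within S make up for the remaining excess, at most |A| + q - n. *)
Record config d q A B M : Prop := Config {
  cf_disj : [disjoint A & B];
  cf_match : matching e A M;
  cf_nonadj : {in B, forall b, #|A :\: nbrs e b| <= 107 * d};
  cf_A : n <= #|A| + 4 * d;
  cf_A' : #|A| <= n + 4 * d;
  cf_B : n <= #|B| + 4 * d;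
  cf_rest : #|~: (A :|: B)| <= 4 * d;
  cf_restA : {in ~: (A :|: B), forall y,
    8 * (#|~: (A :|: B)| + size M) + 8 * q <= #|nbrs e y :&: A|};
  cf_size : (#|A| + q <= n) || (#|A| <= n + q) && (size M == 16 * q) }.

Lemma card_part P Q : [disjoint P & Q] -> #|P| + #|Q| + #|~: (P :|: Q)| = 2 * n.
Proof.
move=> dPQ; rewrite -cardT2 -(cardsC (P :|: Q)); congr (_ + _).
by rewrite cardsU (disjoint_setI0 dPQ) cards0 subn0.
Qed.

Lemma config_small d q P Q : near_extremal e n d P Q -> q <= d ->
  {in Q, forall b, #|P :\: nbrs e b| <= 107 * d} ->
  #|P| + q <= n -> config d q P Q [::].
Proof.
case=> dPQ cY cP cQ hYP hYQ qd hQ hP; split; rewrite ?hP //; try lia.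
move=> y yY; apply: leq_trans (hYP _ yY); rewrite /= addn0; lia.
Qed.

Lemma subset_of_card X k : k <= #|X| -> exists2 Z : {set T}, Z \subset X & #|Z| = k.
Proof.
move=> kX; exists [set x in take k (enum X)].
  by apply/subsetP => x; rewrite inE => /mem_take; rewrite mem_enum.
rewrite cardsE (card_uniqP _) ?take_uniq ?enum_uniq // size_takel //.
by rewrite -cardE.
Qed.

Lemma restC P Q X Y : [disjoint P & Q] -> X \subset P -> Y \subset Q ->
  ~: ((P :\: X) :|: (Q :\: Y)) = ~: (P :|: Q) :|: (X :|: Y).
Proof.
move=> dPQ /subsetP XP /subsetP YQ; apply/setP => x; rewrite !inE.
case xX: (x \in X) => /=.
  have xP := XP _ xX; rewrite (disjointFr dPQ xP) andbF /= orbT.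
  by [].
case xY: (x \in Y) => /=; last by rewrite !orbF.
by have xQ := YQ _ xY; rewrite (disjointFl dPQ xQ) xQ.
Qed.

Lemma config_stars d q P Q : near_extremal e n d P Q -> 4 * q <= d ->
  100 * d <= n ->
  {in Q, forall b, #|P :\: nbrs e b| <= 107 * d} ->
  n < #|P| + q -> n < #|Q| + q ->
  2 * q <= #|[set a in P | 200 * q <= #|nbrs e a :&: P|]| ->
  exists A, config d q A Q [::].
Proof.
case=> dPQ cY cP cQ hYP hYQ qd dn hQ hP hQ' /subset_of_card[Z ZP cZ].
have ZP' : Z \subset P.
  by apply: subset_trans ZP _; apply/subsetP => x; rewrite inE => /andP[].
have cE := card_part dPQ.
have cA : #|P :\: Z| + 2 * q = #|P|.
  rewrite -cZ cardsD (setIidPr ZP') subnK //; exact: subset_leq_card.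
have rE : ~: (P :\: Z :|: Q) = ~: (P :|: Q) :|: Z.
  by have := restC dPQ ZP' (sub0set Q); rewrite setD0 setU0.
have cY' : #|~: (P :\: Z :|: Q)| <= 4 * q.
  by have := leq_cardU (subxx (~: (P :|: Q) :|: Z)); rewrite rE cZ; lia.
have hN y : #|nbrs e y :&: P| <= #|nbrs e y :&: (P :\: Z)| + 2 * q.
  rewrite -cZ; apply: leq_cardU; apply/subsetP => x; rewrite !inE => /andP[-> ->].
  by case: (x \in Z).
exists (P :\: Z); split => //; try lia.
- apply: disjointWl dPQ; exact: subsetDl.
- by move=> b bQ; apply: leq_trans (hQ _ bQ); apply: subset_leq_card; apply: setSD; apply: subsetDl.
- move=> y; rewrite rE => yYZ; rewrite -rE /= addn0; have := hN y.
  move: yYZ; rewrite inE => /orP[/hYP|/(subsetP ZP)].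
    by move: cY' qd; clear; lia.
  by rewrite inE => /andP[_]; move: cY'; clear; lia.
Qed.

Lemma config_matching d q P Q (ZP := [set a in P | 200 * q <= #|nbrs e a :&: P|])
    (ZQ := [set b in Q | 200 * q <= #|nbrs e b :&: Q|]) :
  near_extremal e n d P Q -> 4 * q <= d -> 400 * d <= n -> 0 < q ->
  {in Q, forall b, #|P :\: nbrs e b| <= 107 * d} ->
  n < #|P| + q -> n < #|Q| + q -> #|ZP| < 2 * q -> #|ZQ| < 2 * q ->
  300 * 100 * q ^ 2 <= n ->
  n <= 2 * \sum_(v in P :\: ZP) #|nbrs e v :&: (P :\: ZP)| ->
  exists M, config d q (P :\: ZP) (Q :\: ZQ) M.
Proof.
case=> dPQ cY cP cQ hYP hYQ qd dn q0 hQ hP hQ' cZP cZQ nq hsum.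
have sP : ZP \subset P by apply/subsetP => x; rewrite inE => /andP[].
have sQ : ZQ \subset Q by apply/subsetP => x; rewrite inE => /andP[].
have cE := card_part dPQ; set A := P :\: ZP in hsum *; set B := Q :\: ZQ.
have cA : #|A| + #|ZP| = #|P|.
  by rewrite cardsD (setIidPr sP) subnK //; apply: subset_leq_card.
have cB : #|B| + #|ZQ| = #|Q|.
  by rewrite cardsD (setIidPr sQ) subnK //; apply: subset_leq_card.
have rE : ~: (A :|: B) = ~: (P :|: Q) :|: (ZP :|: ZQ) by apply: restC.
have cY' : #|~: (A :|: B)| <= 6 * q.
  have := leq_cardU (subxx (~: (P :|: Q) :|: (ZP :|: ZQ))).
  have := leq_cardU (subxx (ZP :|: ZQ)).
  by rewrite rE; move: cE hP hQ' cZP cZQ; clear; lia.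
have hN y : #|nbrs e y :&: P| <= #|nbrs e y :&: A| + 2 * q.
  apply: leq_trans (_ : #|nbrs e y :&: A| + #|ZP| <= _); last by rewrite leq_add2l ltnW.
  apply: leq_cardU; apply/subsetP => x; rewrite [in X in _ -> X]inE => xP.
  rewrite inE in xP; have /andP[xN xP'] := xP.
  by rewrite inE xN inE xP'; case: (x \in ZP).
(* The excess to be made up is at most |A| + q - n <= 2q, and of 16 q edges about 4q survive, hence
   2q with high probability. The matching exists because 4 (16 q) (200 q) = 12800 q^2 is less than n
   / 2. *)
have [||M mM szM] := @exists_matching A (200 * q) (16 * q).-1.
- move=> v; rewrite inE => /andP[vZ vP]; move: vZ; rewrite inE vP -ltnNge /= => vd.
  apply: leq_trans (ltnW vd); apply: subset_leq_card; apply: setIS.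
  exact: subsetDl.
- by move: hsum nq q0; rewrite expnS expn1; set s := \sum_(_ in _) _; clear; nia.
exists M; split => //; try lia.
- by apply: (disjointW _ _ dPQ); apply: subsetDl.
- move=> b; rewrite inE => /andP[_ bQ]; apply: leq_trans (hQ _ bQ).
  by apply: subset_leq_card; apply: setSD; apply: subsetDl.
- move=> y yY; rewrite szM; have := hN y; move: yY; rewrite rE inE => /orP[/hYP|].
    by rewrite -rE; move: cY' qd q0; clear; lia.
  rewrite inE -rE => /orP[|yZQ].
    by rewrite inE => /andP[_]; move: cY' q0; clear; lia.
  have := hQ _ (subsetP sQ _ yZQ); have := cardsID (nbrs e y) P.
  by rewrite setIC; move: cY' hP qd dn q0; clear; lia.
Qed.

(** Summing degrees over A and B, at most 2|A||B| goes across and at most y(n + 1) to the y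
    remaining vertices. Since 4|A||B| <= (2n - y)^2, the quadratic terms in n cancel and at least 2n
    - 2y - y^2/2 is left; the 2n comes from the degrees being n + 1. *)
Lemma sum_inner_degrees A B q : [disjoint A & B] -> #|~: (A :|: B)| <= 6 * q ->
  100 * q ^ 2 <= n -> 0 < q ->
  n <= \sum_(v in A) #|nbrs e v :&: A| + \sum_(v in B) #|nbrs e v :&: B|.
Proof.
move=> dAB cY nq q0; set Y := ~: (A :|: B) in cY.
have cE := card_part dAB; rewrite -/Y in cE.
have split3 v : n.+1 <= #|nbrs e v :&: A| + (#|nbrs e v :&: B| + #|nbrs e v :&: Y|).
  rewrite -(reg v); apply: leq_trans (_ : #|(nbrs e v :&: A) :|: ((nbrs e v :&: B) :|: (nbrs e v :&: Y))| <= _).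
    apply: subset_leq_card; apply/subsetP => x; rewrite !inE => ->.
    by case: (x \in A); case: (x \in B).
  by apply: leq_trans (leq_cardU (subxx _)) _; rewrite leq_add2l leq_cardU.
have sumA (X : {set T}) : #|X| * n.+1 <= \sum_(v in X) #|nbrs e v :&: A| +
   (\sum_(v in X) #|nbrs e v :&: B| + \sum_(v in X) #|nbrs e v :&: Y|).
  by rewrite -sum_nat_const -!big_split /=; apply: leq_sum => v _.
have sAB : \sum_(v in A) #|nbrs e v :&: B| <= #|A| * #|B|.
  rewrite -sum_nat_const; apply: leq_sum => v _.
  by apply: subset_leq_card; apply: subsetIr.
have sAY : \sum_(v in A) #|nbrs e v :&: Y| + \sum_(v in B) #|nbrs e v :&: Y| <= #|Y| * n.+1.
  rewrite (sum_nbrs_sym A Y) (sum_nbrs_sym B Y) -big_split /= -sum_nat_const.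
  apply: leq_sum => v _; rewrite -(reg v).
  rewrite -cardsUI -setIUr -setIIr (disjoint_setI0 dAB) setI0 cards0 addn0.
  by apply: subset_leq_card; apply: subsetIl.
have h1 := sumA A; have h2 := sumA B; have h3 := sum_nbrs_sym B A.
move: h1 h2 h3 sAB sAY cE cY nq q0; rewrite expnS expn1.
set a := #|A|; set b := #|B|; set y := #|Y|.
set s1 := \sum_(_ in A) _; set s2 := \sum_(_ in A) _; set s3 := \sum_(_ in A) _.
set s4 := \sum_(_ in B) _; set s5 := \sum_(_ in B) _; set s6 := \sum_(_ in B) _.
clear => h1 h2 h3 h4 h5 h6 h7 h8 h9.
have k1 : (a + b) * n.+1 <= s1 + s5 + 2 * (a * b) + y * n.+1 by rewrite mulnDl; lia.
have k2 : 4 * (a * b) <= (a + b) ^ 2.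
  exact: (nat_AGM2 a b).
have k3 : a + b = 2 * n - y by lia.
have k4 : y * y <= 6 * q * (6 * q) by apply: leq_mul.
have k5 : q * 1 <= q * q by apply: leq_mul.
have {k3} [m mE] : exists m, n = m + y by exists (n - y); move: k4 k5 h7 h8; clear; lia.
have k6 : a + b = 2 * m + y by move: h6 mE; clear; lia.
move: k1 k2 k4 k5 h7 h8; rewrite k6 mE !expnS expn0 muln1; clear; lia.
Qed.

(* Vertices with at least 200 q neighbours on their own side serve either as
   centres of stars, if there are 2 q of them, or are discarded, in which case
   the inner degrees are small and the inner edges contain a large matching. *)
Lemma exists_config d q P Q : near_extremal e n d P Q ->
  4 * q <= d -> 400 * d <= n -> 0 < q -> 300 * 100 * q ^ 2 <= n ->
  {in P, forall p, #|Q :\: nbrs e p| <= 107 * d} ->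
  {in Q, forall q, #|P :\: nbrs e q| <= 107 * d} ->
  exists A B M, config d q A B M.
Proof.
move=> ne qd dn q0 nq hP hQ; have ne' := near_extremal_sym ne.
have qd' : q <= d by lia.
have dn' : 100 * d <= n by lia.
have [cP|cP] := leqP (#|P| + q) n.
  by exists P, Q, [::]; apply: config_small.
have [cQ|cQ] := leqP (#|Q| + q) n.
  by exists Q, P, [::]; apply: config_small.
set ZP := [set a in P | 200 * q <= #|nbrs e a :&: P|].
set ZQ := [set b in Q | 200 * q <= #|nbrs e b :&: Q|].
have [zP|zP] := leqP (2 * q) #|ZP|.
  have [A cA] := config_stars ne qd dn' hQ cP cQ zP.
  by exists A, Q, [::].
have [zQ|zQ] := leqP (2 * q) #|ZQ|.
  have [A cA] := config_stars ne' qd dn' hP cQ cP zQ.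
  by exists A, P, [::].
have dPQ := ne_disj ne.
have sP : ZP \subset P by apply/subsetP => x; rewrite inE => /andP[].
have sQ : ZQ \subset Q by apply/subsetP => x; rewrite inE => /andP[].
have rE := restC dPQ sP sQ.
have dAB : [disjoint P :\: ZP & Q :\: ZQ].
  by apply: (disjointW _ _ dPQ); apply: subsetDl.
have cY : #|~: (P :\: ZP :|: Q :\: ZQ)| <= 6 * q.
  have := leq_cardU (subxx (~: (P :|: Q) :|: (ZP :|: ZQ))).
  have := leq_cardU (subxx (ZP :|: ZQ)); have := card_part dPQ.
  by rewrite rE; move: cP cQ zP zQ; clear; lia.
have nq' : 100 * q ^ 2 <= n by move: nq; clear; lia.
have := sum_inner_degrees dAB cY nq' q0.
set s1 := \sum_(_ in _) _; set s2 := \sum_(_ in _) _ => hs.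
have [h1|h1] := leqP n (2 * s1).
  have [M cM] := config_matching ne qd dn q0 hQ cP cQ zP zQ nq h1.
  by exists (P :\: ZP), (Q :\: ZQ), M.
have h2 : n <= 2 * s2 by move: hs h1; clear; lia.
have [M cM] := config_matching ne' qd dn q0 hP cQ cP zQ zP nq h2.
by exists (Q :\: ZQ), (P :\: ZP), M.
Qed.

End BipartiteConfiguration.

Section ConfigHam.
Variables (T : finType) (e : rel T) (n : nat).
Hypotheses (es : symmetric e) (ei : irreflexive e).
Hypotheses (cardT2 : #|T| = 2 * n) (reg : forall v, #|nbrs e v| = n.+1).
Implicit Types (A B P Q S W X Y Z : {set T}) (M : seq (T * T)).

(* The size of the symmetric difference of S and ~: A exceeds n by
   (|S :&: A| - |S :\: A|) - (|A| - n), the deviation of the excess. *)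
Lemma config_ham d q tau A B M S : config e n d (8 * q) A B M ->
  balanced tau setT S -> balanced tau B S ->
  (forall v, balanced tau (nbrs e v) S) ->
  {in B, forall b, balanced q (nbrs e b :\: A) S} ->
  {in B, forall b, balanced q (A :\: nbrs e b) S} ->
  {in ~: (A :|: B), forall y, #|nbrs e y :&: A| <= 4 * #|(nbrs e y :&: A) :&: S|} ->
  (size M = 16 * (8 * q) -> 2 * (8 * q) <= size (surviving S M)) ->
  n + 4 * q <= #|(S :\: ~: A) :|: (~: A :\: S)| < n + 8 * q ->
  tau <= d -> 1000 * d <= n -> 0 < d -> ham e S.
Proof.
case=> dAB mM hB cA cA' cB cY hYA cM /andP[_ bT] /andP[bB _] bN bNA bAN bY surv.
move=> /andP[Slo Shi] td dn d0.
have cAC : #|A| + #|~: A| = 2 * n by rewrite cardsC.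
have symE : #|(S :\: ~: A) :|: (~: A :\: S)| = #|S :&: A| + #|~: A :\: S|.
  rewrite cardsU (_ : (S :\: ~: A) :&: (~: A :\: S) = set0); last first.
    by apply/setP => x; rewrite !inE; case: (x \in S); case: (x \in A).
  by rewrite cards0 subn0 setDE setCK.
have cAS : #|~: A :\: S| + #|S :\: A| = #|~: A|.
  by rewrite -(cardsID S (~: A)) addnC [S :\: A]setDE [S :&: _]setIC.
have cS : #|S :&: A| + #|S :\: A| = #|S| by apply: cardsID.
have cS2 : 2 * #|S| <= 2 * n + tau by move: bT; rewrite setTI cardsT cardT2.
have nlow v : n.+1 <= 2 * #|nbrs e v :&: S| + tau.
  by have /andP[+ _] := bN v; rewrite reg.
apply: (@ham_near_bipartite _ e es ei A B M S) => //.
- have [b bB'] : exists b, b \in B.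
    by apply/set0Pn; rewrite -card_gt0; move: cB dn d0; clear; lia.
  have := nlow b; have := subset_leq_card (subsetIr (nbrs e b) S).
  by move: td dn d0; clear; lia.
- by rewrite -card_gt0; move: bB cB td dn d0; clear; lia.
- move=> b; rewrite inE => /andP[bB' _].
  have /andP[h1 _] := bNA b bB'; have /andP[_ h2] := bAN b bB'.
  (* Passing from A to the neighbourhood of b changes two sets, balanced up to q. Twice the degree
     of b in S, minus |S|, is thus the deviation of the excess, at least 4q, plus 1, with an error
     of at most 2q. *)
  have h3 : #|nbrs e b :&: S| + #|(A :\: nbrs e b) :&: S| =
            #|S :&: A| + #|(nbrs e b :\: A) :&: S|.
    have := cardsID A (nbrs e b :&: S); have := cardsID (nbrs e b) (S :&: A).
    have -> : nbrs e b :&: S :\: A = (nbrs e b :\: A) :&: S.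
      by apply/setP => x; rewrite !inE andbA.
    have -> : S :&: A :\: nbrs e b = (A :\: nbrs e b) :&: S.
      by apply/setP => x; rewrite !inE; case: (x \in S); rewrite ?andbF ?andbT.
    have -> : S :&: A :&: nbrs e b = nbrs e b :&: S :&: A.
      by rewrite setIC setIA.
    by clear; lia.
  have h4 : #|nbrs e b :\: A| + #|A| = n.+1 + #|A :\: nbrs e b|.
    have := cardsID A (nbrs e b); have := cardsID (nbrs e b) A.
    by rewrite reg setIC; clear; lia.
  by move: h1 h2 h3 h4 Slo symE cAS cAC cS; clear; lia.
- move=> b w; rewrite inE => /andP[bB' bS] _.
  have h1 : #|S :\: B| <= #|nbrs e b :&: (S :\: B)| + (#|A :\: nbrs e b| + #|~: (A :|: B)|).
    apply: leq_trans (_ : #|(nbrs e b :&: (S :\: B)) :|: ((A :\: nbrs e b) :|: ~: (A :|: B))| <= _).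
      apply: subset_leq_card; apply/subsetP => x; rewrite !inE => /andP[/negPf-> ->].
      by case: (e b x); case: (x \in A).
    by apply: leq_trans (leq_cardU (subxx _)) _; rewrite leq_add2l leq_cardU.
  have := hB _ bB'; have := nlow w; have := cardsID B S.
  by rewrite [S :&: B]setIC; move: h1 cY td dn d0; clear; lia.
- move=> y; rewrite inE => /andP[yAB _]; have yY : y \in ~: (A :|: B) by rewrite inE.
  by have := hYA _ yY; have := bY _ yY; rewrite setIA; clear; lia.
- case/orP: cM => [hA|/andP[hA /eqP/surv hs]].
    by move: hA Shi symE cAS cAC; clear; lia.
  by move: hA hs Shi symE cAS cAC; clear; lia.
Qed.

End ConfigHam.

(** * Counting the Hamiltonian sets *)

Section Surviving.
Variables (T : finType) (R : realType).
Implicit Types (S F : {set T}) (M : seq (T * T)).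
Local Open Scope ring_scope.

Lemma sum_superset F : \sum_(S : {set T}) (F \subset S)%:R = 2 ^+ #|T| / 2 ^+ #|F| :> R.
Proof.
have -> : \sum_(S : {set T}) (F \subset S)%:R = #|[set S : {set T} | F \subset S]|%:R :> R.
  rewrite -sum1_card natr_sum [RHS]big_mkcond /=; apply: eq_bigr => S _.
  by rewrite inE; case: (F \subset S).
have : 2 ^+ #|F| != 0 :> R by rewrite expf_neq0 // pnatr_eq0.
move=> h; apply: (canRL (mulfK h)).
by rewrite -[2]/(2%:R) -!natrX -natrM card_supersets.
Qed.

(** Four times the centred indicator that both ends of a pair lie in S. Disjoint pairs become
    orthogonal, so only the diagonal terms, of mean square 3, enter the variance. *)
Definition pair_dev (p : T * T) S : R := 4 * ((p.1 \in S) && (p.2 \in S))%:R - 1.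

Lemma sum_pair_dev2 p : p.1 != p.2 ->
  \sum_(S : {set T}) pair_dev p S * pair_dev p S = 3 * 2 ^+ #|T|.
Proof.
move=> p12.
rewrite (eq_bigr (fun S : {set T} => 8 * ([set p.1; p.2] \subset S)%:R + 1)); last first.
  move=> S _; rewrite /pair_dev subUset !sub1set; case: (_ && _) => /=; ring.
rewrite big_split /= -mulr_sumr sum_superset cards2 p12 sumr_const card_sets.
by rewrite natrX /=; field.
Qed.

Lemma sum_pair_dev p q : uniq [:: p.1; p.2; q.1; q.2] ->
  \sum_(S : {set T}) pair_dev p S * pair_dev q S = 0.
Proof.
move=> u.
have c4 : #|[set p.1; p.2] :|: [set q.1; q.2]| = 4.
  rewrite -[RHS]/(size [:: p.1; p.2; q.1; q.2]) -(card_uniqP u).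
  by apply: eq_card => x; rewrite !inE -!orbA.
have [p12 q12] : p.1 != p.2 /\ q.1 != q.2.
  by move: u; rewrite /= !inE !negb_or => /and4P[/and3P[-> _ _] _ ->].
rewrite (eq_bigr (fun S : {set T} => 16 * ([set p.1; p.2] :|: [set q.1; q.2] \subset S)%:R
  + (- 4 * ([set p.1; p.2] \subset S)%:R + (- 4 * ([set q.1; q.2] \subset S)%:R + 1)))).
  rewrite !big_split /= -!mulr_sumr !sum_superset !cards2 p12 q12 c4 sumr_const card_sets.
  by rewrite natrX /=; field.
move=> S _; rewrite /pair_dev !subUset !sub1set.
by case: (p.1 \in S); case: (p.2 \in S); case: (q.1 \in S); case: (q.2 \in S) => /=; ring.
Qed.

Lemma variance_surviving M : uniq (flatten (pair_segs M)) ->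
  \sum_(S : {set T}) (\sum_(p <- M) pair_dev p S) ^+ 2 = 3 * (size M)%:R * 2 ^+ #|T|.
Proof.
elim: M => [|p M IH] u.
  by rewrite big1 ?mulr0 ?mul0r // => S _; rewrite big_nil expr0n.
have [pM p12 uM] : [/\ ~~ has (mem [:: p.1; p.2]) (flatten (pair_segs M)),
    p.1 != p.2 & uniq (flatten (pair_segs M))].
  move: u; rewrite -[flatten _]/([:: p.1; p.2] ++ flatten (pair_segs M)) cat_uniq.
  by rewrite /= !inE andbT => /and3P[-> -> ->].
under eq_bigr => S _ do rewrite big_cons sqrrD expr2.
rewrite !big_split /= sum_pair_dev2 // IH //.
rewrite (_ : \sum_(S : {set T}) _ = 0).
  by rewrite !addr0 -natr1; ring.
under eq_bigr => S _ do rewrite mulr_sumr.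
rewrite exchange_big /= big_seq big1 // => q qM; apply: sum_pair_dev.
have sub : {subset [:: q.1; q.2] <= flatten (pair_segs M)}.
  by move=> x xq; apply/flattenP; exists [:: q.1; q.2] => //; apply/mapP; exists q.
have q12 : q.1 != q.2.
  move: uM qM; elim: (M) => //= r M' IH' /and3P[h1 _ h2].
  rewrite inE => /orP[/eqP->|]; last exact: IH'.
  by move: h1; rewrite inE negb_or => /andP[].
have hq x : x \in [:: q.1; q.2] -> x \notin [:: p.1; p.2].
  by move=> /sub xM; apply: contra pM => xp; apply/hasP; exists x.
rewrite -[[:: _; _; _; _]]/([:: p.1; p.2] ++ [:: q.1; q.2]) cat_uniq /= !inE p12 q12.
have h1 := hq q.1 (mem_head _ _); have h2 := hq q.2 _; rewrite !inE in h1 h2.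
by rewrite orbF negb_or (negPf h1) h2 ?eqxx ?orbT.
Qed.

(** Chebyshev's inequality at half the mean |M| / 4. The weak bound is enough: with |M| of order
    sqrt n it is negligible against a probability bounded below. *)
Lemma few_surviving M : uniq (flatten (pair_segs M)) ->
  #|[set S : {set T} | (8 * size (surviving S M) < size M)%N]|%:R * (size M)%:R <=
    12 * 2 ^+ #|T| :> R.
Proof.
move=> uM; set D := [set S : {set T} | _].
have [->|M0] := posnP (size M).
  by rewrite mulr0 mulr_ge0 ?exprn_ge0.
have M0' : 0 < (size M)%:R :> R by rewrite ltr0n.
have devE S : \sum_(p <- M) pair_dev p S = 4 * (size (surviving S M))%:R - (size M)%:R.
  elim: (M) => [|p M' IH]; first by rewrite big_nil /= mulr0 subr0.
  rewrite big_cons IH /surviving /= /pair_dev; case: (_ && _) => /=.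
    by rewrite -!natr1; ring.
  by rewrite -natr1; ring.
have : #|D|%:R * ((size M)%:R / 2) ^+ 2 <= 3 * (size M)%:R * 2 ^+ #|T| :> R.
  rewrite -variance_surviving // mulr_natl -sumr_const [leLHS]big_mkcond /=.
  apply: ler_sum => S _; case: ifP => [|_]; last exact: sqr_ge0.
  rewrite inE devE -(ltr_nat R) natrM => h.
  have h0 : 0 <= (size (surviving S M))%:R :> R by apply: ler0n.
  move: h h0; set a := (size (surviving S M))%:R; set b := (size M)%:R => h h0.
  have -> : (4 * a - b) ^+ 2 = (b - 4 * a) ^+ 2 by ring.
  by rewrite lerXn2r ?nnegrE //; lra.
move=> h; rewrite -(ler_pM2r M0').
move: h; set a := #|D|%:R; set b := (size M)%:R; set c := 2 ^+ _ => h.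
have -> : a * b * b = 4 * (a * (b / 2) ^+ 2) by field.
have -> : 12 * c * b = 4 * (3 * b * c) by ring.
by rewrite ler_pM2l.
Qed.

Lemma union_bound (I : finType) (P : I -> pred {set T}) (eta : R) :
  (forall i, #|[set S | P i S]|%:R <= eta) ->
  #|[set S | [exists i, P i S]]|%:R <= #|I|%:R * eta.
Proof.
move=> h; apply: (@le_trans _ _ (\sum_(i : I) #|[set S | P i S]|%:R)).
  rewrite -natr_sum ler_nat.
  rewrite (eq_bigr (fun i => \sum_(S : {set T}) P i S)%N) => [|i _]; last first.
    rewrite -sum1_card big_mkcond /=; apply: eq_bigr => S _.
    by rewrite inE; case: (P i S).
  rewrite exchange_big /= -sum1_card big_mkcond /=; apply: leq_sum => S _.
  rewrite inE; case: existsP => // -[i Pi].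
  by rewrite (bigD1 i) //= Pi.
apply: le_trans (ler_sum _ (fun i _ => h i)) _.
by rewrite sumr_const mulr_natl.
Qed.

End Surviving.

(** * Union bounds over the exceptional events *)

Section CountingHamiltonianSets.
Variables (R : realType) (T : finType) (e : rel T) (n tau d q r : nat) (eta : R).
Hypotheses (es : symmetric e) (ei : irreflexive e).
Hypotheses (cardT2 : #|T| = 2 * n) (reg : forall v, #|nbrs e v| = n.+1).
Let K := 45 * tau + 20.
Hypotheses (q0 : 0 < q) (Kd : K <= d) (dn : 1000 * d <= n) (qd : 32 * q <= d).
Hypotheses (nK : 2 * n * K <= d * d) (nq : 300 * 100 * (8 * q) ^ 2 <= n).
Hypothesis (nr : n <= r ^ 2).
Local Open Scope ring_scope.
Hypothesis eta1 : 2 * expR (- (tau%:R ^+ 2 / (8 * (2 * n)%:R))) <= eta.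
Hypothesis eta2 : 2 * expR (- (q%:R ^+ 2 / (8 * (112 * d)%:R))) <= eta.
Hypothesis eta3 : 2 * expR (- (q%:R / 2)) <= eta.
Implicit Types (A B F P Q S X Y : {set T}).

Notation N := (2 ^+ #|T| : R).
Definition ham_sets : {set {set T}} := [set S | `[< ham e S >]].
Definition unbalanced t F : {set {set T}} := [set S | ~~ balanced t F S].

Let N0 : 0 <= N. Proof. exact: exprn_ge0. Qed.
Let n0 : (0 < n)%N. Proof. by move: dn qd q0; clear; lia. Qed.
Let d0 : (0 < d)%N. Proof. by move: qd q0; clear; lia. Qed.
Let taud : (tau <= d)%N. Proof. by move: Kd; rewrite /K; clear; lia. Qed.
Let eta0 : 0 <= eta.
Proof. by apply: le_trans eta3; rewrite mulr_ge0 ?expR_ge0. Qed.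

Let cTR : #|T|%:R = 2 * n%:R :> R. Proof. by rewrite cardT2 natrM. Qed.

Lemma unbalanced_tau F : #|unbalanced tau F|%:R <= eta * N.
Proof.
apply: le_trans (@chernoff T R F (2 * n) tau _ _ _) _.
- by rewrite -cardT2 max_card.
- by rewrite muln_gt0 n0.
- by move: taud dn; clear; lia.
- by rewrite ler_wpM2r.
Qed.

(** This is for the two differences between A and the neighbourhood of a vertex of B: one has size
    at most 107 d, the other at most 107 d + 4d + 1. *)
Lemma unbalanced_q F : (#|F| <= 112 * d)%N -> #|unbalanced q F|%:R <= eta * N.
Proof.
move=> hF; apply: le_trans (@chernoff T R F (112 * d) q hF _ _) _.
- by rewrite muln_gt0 d0.
- by move: qd; clear; lia.
- by rewrite ler_wpM2r.
Qed.

(** A deviation by [#|F|./2], which is at least |F| / 4, has an exponent of at least |F| / 128,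
    hence of at least q / 2. *)
Lemma unbalanced_half F : (64 * q <= #|F|)%N ->
  #|[set S | (4 * #|F :&: S| < #|F|)%N]|%:R <= eta * N.
Proof.
move=> hF; have F0 : (0 < #|F|)%N by move: hF q0; clear; lia.
apply: (@le_trans _ _ #|unbalanced (#|F|./2) F|%:R).
  rewrite ler_nat; apply: subset_leq_card; apply/subsetP => S; rewrite !inE => h.
  rewrite negb_and -!ltnNge; apply/orP; left.
  by have := odd_double_half #|F|; move: h; clear; case: odd; lia.
apply: le_trans (@chernoff T R F #|F| (#|F|./2) (leqnn _) F0 _) _.
  by have := odd_double_half #|F|; clear; lia.
rewrite ler_wpM2r //; apply: le_trans eta3; rewrite ler_pM2l // ler_expR lerN2.
have h1 : (#|F| <= 4 * #|F|./2)%N.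
  by have := odd_double_half #|F|; move: hF q0; clear; case: odd; lia.
have {}h1 : #|F|%:R <= 4 * #|F|./2%:R :> R by rewrite -natrM ler_nat.
have h2 : 64 * q%:R <= #|F|%:R :> R by rewrite -natrM ler_nat.
have h3 : 0 < #|F|%:R :> R by rewrite ltr0n.
move: h1 h2 h3; set f := #|F|%:R; set g := _./2%:R; set x := q%:R => h1 h2 h3.
rewrite ler_pdivlMr ?mulr_gt0 //; apply: (@le_trans _ _ (f ^+ 2 / 16)).
  rewrite expr2 -mulrA; have := ler_wpM2l (ltW h3) h2; lra.
have h4 : f ^+ 2 <= (4 * g) ^+ 2 by rewrite lerXn2r ?nnegrE //; lra.
rewrite exprMn in h4; lra.
Qed.

Lemma notinU (I : finType) (X Y : {set I}) x :
  x \notin X :|: Y -> x \notin X /\ x \notin Y.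
Proof. by rewrite inE negb_or => /andP. Qed.

Lemma count_nonextremal : (forall u, (#|twins e K u| + K < n)%N) ->
  N <= #|ham_sets|%:R + 9 * n%:R ^+ 2 * (eta * N).
Proof.
move=> next.
pose B0 := unbalanced tau setT.
pose B1 := [set S | [exists v, ~~ balanced tau (nbrs e v) S]].
pose B2 := [set S | [exists p : T * T, ~~ balanced tau (nbrs e p.1 :\: nbrs e p.2) S]].
pose B3 := [set S | [exists u, ~~ balanced tau (twins e K u) S]].
have cov : (#|{set T}| <= #|ham_sets| + (#|B0| + (#|B1| + (#|B2| + #|B3|))))%N.
  rewrite -cardsT; apply: leq_trans (_ : #|ham_sets :|: (B0 :|: (B1 :|: (B2 :|: B3)))| <= _)%N.
    apply: subset_leq_card; apply/subsetP => S _.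
    case: (boolP (S \in B0 :|: (B1 :|: (B2 :|: B3)))) => h; first by rewrite inE h orbT.
    rewrite inE; apply/orP; left; rewrite inE; apply/asboolP; apply: contrapT => nham.
    have [b0 /notinU[b1 /notinU[b2 b3]]] := notinU h.
    rewrite inE negbK in b0; rewrite inE in b1; rewrite inE in b2; rewrite inE in b3.
    move: b1 b2 b3 => /existsPn b1 /existsPn b2 /existsPn b3.
    have [|||||u] := @nonham_twins T e n es ei cardT2 reg tau S _ _ _ _ _ nham.
    - by move: Kd dn; rewrite /K; clear; lia.
    - by [].
    - by move=> v; have := b1 v; rewrite negbK.
    - by move=> v w; have := b2 (v, w); rewrite negbK.
    - by move=> u; have := b3 u; rewrite negbK.
    - by rewrite leqNgt next.
  apply: leq_trans (leq_cardU (subxx _)) _; rewrite leq_add2l.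
  apply: leq_trans (leq_cardU (subxx _)) _; rewrite leq_add2l.
  apply: leq_trans (leq_cardU (subxx _)) _; rewrite leq_add2l.
  exact: leq_cardU (subxx _).
have h0 := unbalanced_tau setT.
have h1 := union_bound (fun v => unbalanced_tau (nbrs e v)).
have h2 := union_bound (fun p : T * T => unbalanced_tau (nbrs e p.1 :\: nbrs e p.2)).
have h3 := union_bound (fun u => unbalanced_tau (twins e K u)).
have n1 : 1 <= n%:R :> R by rewrite ler1n.
have n2 : n%:R <= n%:R ^+ 2 :> R by rewrite expr2 -{1}[n%:R]mulr1 ler_wpM2l.
rewrite -(ler_nat R) card_sets natrX !natrD in cov.
rewrite cTR in h1 h3; rewrite card_prod natrM !cTR in h2.
have eN : 0 <= eta * N by rewrite mulr_ge0.
apply: le_trans cov _; rewrite lerD2l.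
apply: le_trans (lerD h0 (lerD h1 (lerD h2 h3))) _.
have -> : eta * N + (2 * n%:R * (eta * N) + (2 * n%:R * (2 * n%:R) * (eta * N) +
   2 * n%:R * (eta * N))) = (1 + 4 * n%:R + 4 * n%:R ^+ 2) * (eta * N) by ring.
by rewrite ler_wpM2r //; lra.
Qed.

Lemma count_cliques P Q : near_extremal e n d P Q ->
  {in P, forall p, #|P :\: nbrs e p| <= 107 * d}%N ->
  {in Q, forall q, #|Q :\: nbrs e q| <= 107 * d}%N ->
  (#|P| <= #|Q|)%N ->
  N / 16 <= #|ham_sets|%:R + 9 * n%:R ^+ 2 * (eta * N).
Proof.
move=> ne hP hQ hPQ.
have [|||x1 [x2 [q1 [q2 [[x12 q12 e1 e2] [x1Q x2Q q1Q q2Q]]]]]] :=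
  @two_crossing_edges T e n ei cardT2 reg d P Q ne.
- exact: d0.
- by move: dn d0; clear; lia.
- by left.
pose F := [set x1; x2; q1; q2].
have cF : #|F| = 4.
  have u : uniq [:: x1; x2; q1; q2].
    have nQ x y : x \notin Q -> y \in Q -> x != y.
      by move=> xQ yQ; apply: contraNneq xQ => ->.
    by rewrite /= !inE !negb_or x12 q12 !nQ.
  rewrite -[RHS]/(size [:: x1; x2; q1; q2]) -(card_uniqP u).
  by apply: eq_card => x; rewrite !inE -!orbA.
pose B0 := unbalanced tau P; pose B1 := unbalanced tau Q.
pose B2 := [set S | [exists v, ~~ balanced tau (nbrs e v :&: P) S]].
have cov : (#|[set S : {set T} | F \subset S]| <= #|ham_sets| + (#|B0| + (#|B1| + #|B2|)))%N.
  apply: leq_trans (_ : #|ham_sets :|: (B0 :|: (B1 :|: B2))| <= _)%N.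
    apply: subset_leq_card; apply/subsetP => S; rewrite inE => FS.
    case: (boolP (S \in B0 :|: (B1 :|: B2))) => h; first by rewrite inE h orbT.
    rewrite inE; apply/orP; left; rewrite inE; apply/asboolP.
    have [b0 /notinU[b1 b2]] := notinU h.
    rewrite inE negbK in b0; rewrite inE negbK in b1; rewrite inE in b2.
    move: b2 => /existsPn b2.
    apply: (@ham_two_cliques T e n es ei d tau P Q S x1 x2 q1 q2) => //.
    by move=> v; have := b2 v; rewrite negbK.
  apply: leq_trans (leq_cardU (subxx _)) _; rewrite leq_add2l.
  apply: leq_trans (leq_cardU (subxx _)) _; rewrite leq_add2l.
  exact: leq_cardU (subxx _).
have h0 := unbalanced_tau P; have h1 := unbalanced_tau Q.
have h2 := union_bound (fun v => unbalanced_tau (nbrs e v :&: P)).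
have n1 : 1 <= n%:R :> R by rewrite ler1n.
have n2 : n%:R <= n%:R ^+ 2 :> R by rewrite expr2 -{1}[n%:R]mulr1 ler_wpM2l.
have cS : #|[set S : {set T} | F \subset S]|%:R = N / 16 :> R.
  have := card_supersets F; rewrite cF => h.
  have -> : N = #|[set S : {set T} | F \subset S]|%:R * 16 by rewrite -natrX -h natrM.
  by field.
rewrite -(ler_nat R) !natrD cS in cov; rewrite cTR in h2.
have eN : 0 <= eta * N by rewrite mulr_ge0.
apply: le_trans cov _; rewrite lerD2l.
apply: le_trans (lerD h0 (lerD h1 h2)) _.
have -> : eta * N + (eta * N + 2 * n%:R * (eta * N)) = (2 + 2 * n%:R) * (eta * N) by ring.
by rewrite ler_wpM2r //; lra.
Qed.

Lemma count_bipartite A B M : config e n d (8 * q) A B M ->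
  q%:R / r%:R * N <= #|ham_sets|%:R + (10 * n%:R ^+ 2 * (eta * N) + N / q%:R).
Proof.
move=> cf; have [dAB mM hB cA cA' cB cY hYA cM] := cf.
pose D := [set S : {set T} | (n + 4 * q <= #|S| < n + 8 * q)%N].
pose E := [set S : {set T} | (S :\: ~: A) :|: (~: A :\: S) \in D].
pose B0 := unbalanced tau setT; pose B1 := unbalanced tau B.
pose B2 := [set S | [exists v, ~~ balanced tau (nbrs e v) S]].
pose B3 := [set S | [exists v, (v \in B) && ~~ balanced q (nbrs e v :\: A) S]].
pose B4 := [set S | [exists v, (v \in B) && ~~ balanced q (A :\: nbrs e v) S]].
pose B5 := [set S | [exists y, (y \in ~: (A :|: B)) &&
   (4 * #|(nbrs e y :&: A) :&: S| < #|nbrs e y :&: A|)%N]].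
pose B6 := [set S : {set T} | (size M == 16 * (8 * q))%N && (8 * size (surviving S M) < size M)%N].
have cov : (#|E| <= #|ham_sets| + (#|B0| + (#|B1| + (#|B2| + (#|B3| + (#|B4| + (#|B5| + #|B6|)))))))%N.
  apply: leq_trans (_ : #|ham_sets :|: (B0 :|: (B1 :|: (B2 :|: (B3 :|: (B4 :|: (B5 :|: B6))))))| <= _)%N.
    apply: subset_leq_card; apply/subsetP => S; rewrite inE => SD.
    case: (boolP (S \in (B0 :|: (B1 :|: (B2 :|: (B3 :|: (B4 :|: (B5 :|: B6)))))))) => h.
      by rewrite inE h orbT.
    rewrite inE; apply/orP; left; rewrite inE; apply/asboolP.
    have [b0 /notinU[b1 /notinU[b2 /notinU[b3 /notinU[b4 /notinU[b5 b6]]]]]] := notinU h.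
    rewrite inE negbK in b0; rewrite inE negbK in b1.
    rewrite inE in b2; rewrite inE in b3; rewrite inE in b4; rewrite inE in b5.
    rewrite inE in b6; move: b2 b3 b4 b5 => /existsPn b2 /existsPn b3 /existsPn b4 /existsPn b5.
    apply: (config_ham es ei cardT2 reg cf b0 b1) => //.
    - by move=> v; have := b2 v; rewrite negbK.
    - by move=> v vB; have := b3 v; rewrite vB /= negbK.
    - by move=> v vB; have := b4 v; rewrite vB /= negbK.
    - by move=> y yY; have := b5 y; rewrite yY /= -leqNgt.
    - by move=> sM; move: b6; rewrite sM eqxx /= -leqNgt; clear; lia.
    - by move: SD; rewrite inE.
  do 6! (apply: leq_trans (leq_cardU (subxx _)) _; rewrite leq_add2l).
  exact: leq_cardU (subxx _).
have eN : 0 <= eta * N by rewrite mulr_ge0.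
have h0 := unbalanced_tau setT; have h1 := unbalanced_tau B.
have h2 := union_bound (fun v => unbalanced_tau (nbrs e v)).
have h3 : #|B3|%:R <= #|T|%:R * (eta * N).
  apply: union_bound => v; case: (boolP (v \in B)) => [vB|_]; last first.
    by rewrite (_ : [set _ | _] = set0) ?cards0 //; apply/setP => S; rewrite !inE.
  apply: unbalanced_q; have := hB _ vB; have := cardsID A (nbrs e v).
  have := cardsID (nbrs e v) A; rewrite reg setIC; move: cA d0; clear; lia.
have h4 : #|B4|%:R <= #|T|%:R * (eta * N).
  apply: union_bound => v; case: (boolP (v \in B)) => [vB|_]; last first.
    by rewrite (_ : [set _ | _] = set0) ?cards0 //; apply/setP => S; rewrite !inE.
  by apply: unbalanced_q; have := hB _ vB; clear; lia.
have h5 : #|B5|%:R <= #|T|%:R * (eta * N).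
  apply: union_bound => y; case: (boolP (y \in ~: (A :|: B))) => [yY|_]; last first.
    by rewrite (_ : [set _ | _] = set0) ?cards0 //; apply/setP => S; rewrite !inE.
  by apply: unbalanced_half; have := hYA _ yY; clear; lia.
have q0' : 0 < q%:R :> R by rewrite ltr0n.
have h6 : #|B6|%:R <= N / q%:R.
  rewrite ler_pdivlMr //; have [sM|sM] := eqVneq (size M) (16 * (8 * q))%N; last first.
    rewrite (_ : B6 = set0) ?cards0 ?mul0r //.
    by apply/setP => S; rewrite !inE (negPf sM).
  have uM : uniq (flatten (pair_segs M)) by case/and3P: mM.
  have := few_surviving R uM; rewrite sM !natrM.
  have : #|B6|%:R <= #|[set S : {set T} | (8 * size (surviving S M) < 16 * (8 * q))%N]|%:R :> R.
    rewrite ler_nat; apply: subset_leq_card; apply/subsetP => S.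
    by rewrite !inE sM => /andP[].
  move=> /(ler_wpM2r (ltW q0')).
  move: N0; set b := #|B6|%:R * _; set a := #|_|%:R; nra.
have r0 : (0 < r)%N.
  by rewrite lt0n; apply: contraTneq nr => ->; rewrite exp0n // leqn0 -lt0n.
have r0' : 0 < r%:R :> R by rewrite ltr0n.
have hE : q%:R / r%:R * N <= #|E|%:R.
  have bn : (2 * (8 * q) ^ 2 <= n)%N by move: nq; clear; lia.
  have ab : (4 * q <= 8 * q)%N by rewrite leq_mul2r orbT.
  (* The window has length 4q, which against the factor 4r gives the probability q / r. *)
  have := card_sets_near_half cardT2 bn nr ab n0.
  rewrite /E card_preim_symdiff -/D -mulnBl (_ : 8 - 4 = 4)%N // -(ler_nat R) !natrM natrX => h.
  rewrite mulrAC ler_pdivrMr //; lra.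
have n1 : 1 <= n%:R :> R by rewrite ler1n.
have n2 : n%:R <= n%:R ^+ 2 :> R by rewrite expr2 -{1}[n%:R]mulr1 ler_wpM2l.
rewrite -(ler_nat R) !natrD in cov; rewrite cTR in h2 h3 h4 h5.
apply: le_trans hE _; apply: le_trans cov _; rewrite lerD2l.
apply: le_trans (lerD h0 (lerD h1 (lerD h2 (lerD h3 (lerD h4 (lerD h5 h6)))))) _.
have -> : eta * N + (eta * N + (2 * n%:R * (eta * N) + (2 * n%:R * (eta * N) +
  (2 * n%:R * (eta * N) + (2 * n%:R * (eta * N) + N / q%:R))))) =
  (2 + 8 * n%:R) * (eta * N) + N / q%:R by ring.
by rewrite lerD2r ler_wpM2r //; lra.
Qed.

Lemma count_ham (c : R) : c + 10 * n%:R ^+ 2 * eta <= 1 / 16 ->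
  c + 10 * n%:R ^+ 2 * eta + q%:R^-1 <= q%:R / r%:R ->
  c * N <= #|ham_sets|%:R.
Proof.
move=> h1 h2; have e0 : 0 <= n%:R ^+ 2 * (eta * N).
  by rewrite mulr_ge0 ?exprn_ge0 // mulr_ge0.
have k1 : c * N + 10 * (n%:R ^+ 2 * (eta * N)) <= N / 16.
  have -> : c * N + 10 * (n%:R ^+ 2 * (eta * N)) = (c + 10 * n%:R ^+ 2 * eta) * N by ring.
  have -> : N / 16 = 1 / 16 * N by ring.
  exact: ler_wpM2r.
have k2 : c * N + 10 * (n%:R ^+ 2 * (eta * N)) + N / q%:R <= q%:R / r%:R * N.
  have -> : c * N + 10 * (n%:R ^+ 2 * (eta * N)) + N / q%:R =
     (c + 10 * n%:R ^+ 2 * eta + q%:R^-1) * N by ring.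
  exact: ler_wpM2r.
have E' : 9 * n%:R ^+ 2 * (eta * N) = 9 * (n%:R ^+ 2 * (eta * N)) by ring.
have E2 : 10 * n%:R ^+ 2 * (eta * N) = 10 * (n%:R ^+ 2 * (eta * N)) by ring.
have [[u hu]|next] := pselect (exists u, (n <= #|twins e K u| + K)%N); last first.
  have := count_nonextremal; rewrite E' => k3.
  suff : N <= #|ham_sets|%:R + 9 * (n%:R ^+ 2 * (eta * N)).
    by move: N0 k1 e0; lra.
  by apply: k3 => u; rewrite ltnNge; apply/negP => hu; apply: next; exists u.
have dn' : (400 * d <= n)%N by move: dn; clear; lia.
have [P [Q [ne [[hP hQ]|[hP hQ]]]]] := twins_structure es cardT2 reg d0 Kd (leqnn d) dn' nK hu.
  have k3 : N / 16 <= #|ham_sets|%:R + 9 * (n%:R ^+ 2 * (eta * N)).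
    rewrite -E'; have [PQ|/ltnW QP] := leqP #|P| #|Q|; first exact: (count_cliques ne).
    exact: (count_cliques (near_extremal_sym ne)).
  by move: k1 k3 e0; lra.
have [||A [B [M cf]]] := exists_config es ei cardT2 reg (q := 8 * q) ne _ dn' _ nq hP hQ.
- by move: qd; clear; lia.
- by move: q0; clear; lia.
have := count_bipartite cf; rewrite E2; move: k2 e0; lra.
Qed.

End CountingHamiltonianSets.

Lemma ham_induced (G : sgraph) (S : {set G}) :
  ham (@adj G) S -> hamiltonian (induced S).
Proof.
move=> [p [p3 cp up pS]].
have [s sp] : exists s : seq (induced S), [seq val x | x <- s] = p.
  have : {subset p <= S} by move=> x; rewrite pS.
  elim: (p) => [|x s IH] sS; first by exists [::].
  have [|t <-] := IH; first by move=> y ys; apply: sS; rewrite inE ys orbT.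
  by exists ((exist _ x (sS x (mem_head _ _)) : induced S) :: t).
exists s; rewrite -sp in p3 cp up pS; split.
- by rewrite size_map in p3.
- by apply/andP; rewrite cycle_map (map_inj_uniq val_inj) in cp up *; split.
- by move=> x; rewrite -(mem_map val_inj) pS (valP x).
Qed.

(** For bounded n a single Hamiltonian subset suffices. Adjacent vertices have 2n + 2 neighbours in
    total among 2n vertices, hence a common one. *)
Lemma exists_triangle (T : finType) (e : rel T) n :
  symmetric e -> irreflexive e -> #|T| = 2 * n -> 0 < n ->
  (forall v, #|nbrs e v| = n.+1) -> exists S, ham e S.
Proof.
move=> es ei cT n0 reg.
have [u _] : exists u : T, u \in [set: T].
  by apply/set0Pn; rewrite -card_gt0 cardsT cT; lia.
have [v] : exists v, v \in nbrs e u by apply/set0Pn; rewrite -card_gt0 reg.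
rewrite inE => uv.
have [w] : exists w, w \in nbrs e u :&: nbrs e v.
  apply/set0Pn; rewrite -card_gt0.
  have := cardsUI (nbrs e u) (nbrs e v); rewrite !reg.
  have : #|nbrs e u :|: nbrs e v| <= 2 * n by rewrite -cT max_card.
  by clear; lia.
rewrite !inE => /andP[uw vw].
exists [set x in [:: u; v; w]], [:: u; v; w]; split => //.
- by rewrite /= uv vw es uw.
- have ne a b : e a b -> a != b by apply: contraTneq => ->; rewrite ei.
  by rewrite /= !inE negb_or !ne.
- by move=> x; rewrite [RHS]inE.
Qed.

(** * Choice of the parameters for large n *)

Section Asymptotics.
Variable R : realType.
Local Open Scope ring_scope.

(** The power p^16 stands for n^2, the order of the number of events in the union bounds. The term
    of degree 17 in the exponential series beats it by a factor p. *)
Lemma expR_vs_power (C : R) : 0 <= C -> exists p0 : nat, forall p : nat,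
  (p0 <= p)%N -> C * p%:R ^+ 16 * expR (- (p%:R / 1024)) <= 1.
Proof.
move=> C0; pose b : R := 17`!%:R * 1024 ^+ 17.
have b0 : 0 < b by rewrite mulr_gt0 ?exprn_gt0 ?ltr0n ?fact_gt0.
exists (Num.bound (C * b)).+1 => p hp.
have p0 : 0 < p%:R :> R by rewrite ltr0n; apply: leq_ltn_trans hp.
have Cp : C * b <= p%:R.
  apply: (@le_trans _ _ (Num.bound (C * b))%:R); last by rewrite ler_nat ltnW.
  by apply/ltW/archi_boundP; rewrite mulr_ge0 // ltW.
rewrite expRN ler_pdivrMr ?expR_gt0 // mul1r.
have h0 : 0 <= p%:R / 1024 :> R by rewrite divr_ge0 // ltW.
apply: le_trans (expR_ge1Dxn 16 h0); apply: ler_wpDl => //.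
rewrite expr_div_n -mulrA -invfM -/b [_ * 17`!%:R]mulrC -/b.
rewrite ler_pdivlMr // [leRHS]exprS mulrAC ler_wpM2r ?exprn_ge0 //.
Qed.

Lemma count_large : exists c : R, exists2 n0 : nat, 0 < c &
  forall (T : finType) (e : rel T) (n : nat), symmetric e -> irreflexive e ->
    #|T| = (2 * n)%N -> (forall v, #|nbrs e v| = n.+1) -> (n0 <= n)%N ->
    c * 2 ^+ #|T| <= #|ham_sets e|%:R.
Proof.
(* L p^8 <= n <= 256 L p^8, tau = p^5, d = p^7 and q = p^4, so that every
   exceptional event has probability at most 2 exp (- p / 1024). *)
have [L hL] := ex_intro (fun L => 300 * 100 * 64 <= L)%N _ (leqnn _).
have L0 : (0 < L)%N by move: hL; clear; lia.
have L0' : 1 <= L%:R :> R by rewrite ler1n.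
(* The lower bound on [L] is what [nq] requires for q = p^4. With r = 16 L p^4 the ratio q / r is
   [4 * c], and the constant [c], the union bound and 1 / q take at most [c] each. *)
pose c : R := (64 * L%:R)^-1.
have c0 : 0 < c by rewrite invr_gt0 mulr_gt0 ?ltr0n.
pose C : R := 10 * (256 * L%:R) ^+ 2 * 2 * (64 * L%:R).
have C0 : 0 <= C by rewrite /C !mulr_ge0 ?exprn_ge0 ?mulr_ge0.
have [p1 hp1] := expR_vs_power C0.
(* The second bound ensures 2nK <= d^2: the left side is at most 2 (256 L p^8) (65 p^5), and the
   right side is p^14. *)
pose p0 := maxn p1 (65 * 512 * L)%N.
exists c, (L * p0 ^ 8)%N => // T e n es ei cT reg hn.
(* The largest admissible p is taken; 256 is 2^8, from p + 1 <= 2p. *)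
have [p [hp hlo hhi]] : exists p, [/\ (p0 <= p)%N, (L * p ^ 8 <= n)%N & (n <= 256 * L * p ^ 8)%N].
  have P0 : exists p, (L * p ^ 8 <= n)%N by exists p0.
  have Pn p : (L * p ^ 8 <= n)%N -> (p <= n)%N.
    apply: leq_trans; apply: leq_trans (leq_pmull _ L0).
    by case: p => // p; rewrite -{1}[p.+1]expn1 leq_pexp2l.
  have := ex_maxnP P0 Pn; case=> p hp pmax; exists p; split => //; first exact: pmax.
  have : (n < L * p.+1 ^ 8)%N.
    by rewrite ltnNge; apply/negP => /pmax; rewrite ltnn.
  move/ltnW/leq_trans; apply.
  have -> : (256 * L * p ^ 8 = L * (2 * p) ^ 8)%N by rewrite expnMn mulnCA mulnA.
  rewrite leq_mul2l leq_exp2r //; apply/orP; right.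
  suff : (0 < p)%N by clear; lia.
  by apply: leq_trans (pmax _ hn); rewrite leq_max; apply/orP; right; move: L0; clear; lia.
have pL : (65 * 512 * L <= p)%N by apply: leq_trans hp; rewrite leq_maxr.
have pp1 : (p1 <= p)%N by apply: leq_trans hp; rewrite leq_maxl.
have p_gt0 : (0 < p)%N by move: pL L0; clear; lia.
have p65 : (65 <= p)%N by move: pL L0; clear; lia.
have pk k : (0 < p ^ k)%N by rewrite expn_gt0 p_gt0.
have Kd : (45 * p ^ 5 + 20 <= p ^ 7)%N.
  have := leq_mul p65 (leq_mul p65 (leqnn (p ^ 5)%N)); rewrite -!expnS.
  by have := pk 5; clear; lia.
have dn : (1000 * p ^ 7 <= n)%N.
  apply: leq_trans hlo; rewrite [(p ^ 8)%N]expnS; have := leq_pmull (p ^ 7)%N p_gt0.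
  by move: hL; clear; nia.
have qd : (32 * p ^ 4 <= p ^ 7)%N.
  rewrite (_ : 7 = 3 + 4)%N // expnD leq_mul2r; apply/orP; right.
  by apply: leq_trans (leq_trans _ p65) (leq_pexp2l p_gt0 (_ : 1 <= 3)%N).
have nK : (2 * n * (45 * p ^ 5 + 20) <= p ^ 7 * p ^ 7)%N.
  apply: (@leq_trans (2 * (256 * L * p ^ 8) * (65 * p ^ 5))%N).
    apply: leq_mul; first by rewrite leq_mul2l.
    by have := pk 5; clear; lia.
  rewrite -expnD (_ : 7 + 7 = 1 + (8 + 5))%N // expnD expn1 expnD.
  apply: leq_trans (_ : 65 * 512 * L * (p ^ 8 * p ^ 5) <= _)%N; last by rewrite leq_mul2r pL orbT.
  by clear; lia.
have p48 : (p ^ 4 * p ^ 4 = p ^ 8)%N by rewrite -expnD.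
have nq : (300 * 100 * (8 * p ^ 4) ^ 2 <= n)%N.
  apply: leq_trans hlo; rewrite expnMn [((_ ^ 4) ^ 2)%N]expnS expn1 p48 mulnA.
  by rewrite leq_mul2r; apply/orP; right.
have nr : (n <= (16 * L * p ^ 4) ^ 2)%N.
  apply: leq_trans hhi _; rewrite expnMn [((p ^ 4) ^ 2)%N]expnS expn1 p48 leq_mul2r.
  by apply/orP; right; rewrite expnMn [(L ^ 2)%N]expnS expn1; move: L0; clear; nia.
pose x : R := p%:R; have x65 : 65 * 512 * L%:R <= x by rewrite -!natrM ler_nat.
have x1 : 1 <= x by rewrite ler1n.
have x0 : 0 < x by rewrite ltr0n.
have xk k : 1 <= x ^+ k by rewrite exprn_ege1.
have nhi : n%:R <= 256 * L%:R * x ^+ 8 by rewrite -natrX -!natrM ler_nat.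
have n1 : 0 < n%:R :> R.
  by rewrite ltr0n; apply: leq_trans hlo; rewrite muln_gt0 L0 pk.
pose eta : R := 2 * expR (- (x / 1024)).
have eta1 : 2 * expR (- ((p ^ 5)%:R ^+ 2 / (8 * (2 * n)%:R))) <= eta.
  rewrite ler_pM2l // ler_expR lerN2 natrM natrX -/x.
  rewrite ler_pdivlMr ?mulr_gt0 // -exprM.
  have h : L%:R * x ^+ 9 * 4 <= x ^+ 10.
    have -> : x ^+ 10 = x * x ^+ 9 by rewrite -exprS.
    have := xk 9; nra.
  have e9 : x ^+ 9 = x * x ^+ 8 by rewrite -exprS.
  rewrite e9 in h; apply: le_trans h.
  have := ler_wpM2l (ltW x0) nhi; lra.
have eta2 : 2 * expR (- ((p ^ 4)%:R ^+ 2 / (8 * (112 * p ^ 7)%:R))) <= eta.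
  rewrite ler_pM2l // ler_expR lerN2 natrM !natrX -/x.
  have x7 : 0 < x ^+ 7 by rewrite exprn_gt0.
  rewrite ler_pdivlMr ?mulr_gt0 // -exprM (_ : 4 * 2 = 8)%N //.
  have -> : x ^+ 8 = x * x ^+ 7 by rewrite -exprS.
  nra.
have eta3 : 2 * expR (- ((p ^ 4)%:R / 2)) <= eta.
  rewrite ler_pM2l // ler_expR lerN2 natrX -/x.
  have -> : x ^+ 4 = x * x ^+ 3 by rewrite -exprS.
  have := xk 3; nra.
have e0 : 0 < expR (- (x / 1024)) by apply: expR_gt0.
have small : 10 * n%:R ^+ 2 * eta <= c.
  rewrite /c -[leRHS]mul1r ler_pdivlMr ?mulr_gt0 ?ltr0n //.
  apply: le_trans (hp1 p pp1); rewrite /eta -/x.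
  have n2 : n%:R ^+ 2 <= (256 * L%:R * x ^+ 8) ^+ 2.
    by rewrite lerXn2r ?nnegrE ?(ltW n1) // !mulr_ge0 ?exprn_ge0 // ltW.
  rewrite exprMn -exprM (_ : 8 * 2 = 16)%N // in n2.
  have L0'' : 0 <= L%:R * expR (- (x / 1024)) by rewrite mulr_ge0 // ltW.
  have := ler_wpM2r L0'' n2; rewrite /C; lra.
have cL : c * (64 * L%:R) = 1 by rewrite mulVf // gt_eqF // mulr_gt0 ?ltr0n.
have c64 : c <= 1 / 64 by nra.
apply: (@count_ham R T e n (p ^ 5) (p ^ 7) (p ^ 4) (16 * L * p ^ 4) eta) => //.
  lra.
have -> : (p ^ 4)%:R / (16 * L * p ^ 4)%:R = 4 * c.
  rewrite (natrM _ (16 * L)%N) (natrM _ 16) natrX -/x /c; field.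
  by rewrite !gt_eqF ?ltr0n ?exprn_gt0.
have : (p ^ 4)%:R^-1 <= c.
  rewrite /c lef_pV2 ?posrE ?ltr0n ?mulr_gt0 ?ltr0n ?pk // natrX -/x.
  have -> : x ^+ 4 = x * x ^+ 3 by rewrite -exprS.
  have := xk 3; nra.
lra.
Qed.

End Asymptotics.

Local Open Scope ring_scope.

Theorem theorem2p2 (R : realType) :
  exists2 c : R, 0 < c &
    forall (n : nat) (G : sgraph),
      (0 < n)%N -> #|G| = (2 * n)%N -> regular n.+1 G ->
      c <= unif_pr R (fun S : {set G} => hamiltonian (induced S)).
Proof.
have [c1 [n0 c1_gt0 large]] := count_large R.
(* Below the threshold [n0] the triangle alone has probability 2^(-2n), which is at least the second
   term. *)
exists (Num.min c1 (2 ^+ (2 * n0))^-1).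
  by rewrite lt_min c1_gt0 invr_gt0 exprn_gt0.
move=> n G n_gt0 cG regG.
have reg v : #|nbrs (@adj G) v| = n.+1 by rewrite -(regG v) cardsE.
have N_gt0 : 0 < 2 ^+ #|G| :> R by rewrite exprn_gt0.
rewrite /unif_pr card_sets natrX ler_pdivlMr //.
apply: (@le_trans _ _ #|ham_sets (@adj G)|%:R); last first.
  rewrite ler_nat; apply: subset_leq_card; apply/subsetP => S.
  by rewrite !inE => /asboolP hS; apply/asboolP/ham_induced.
have [n0n|nn0] := leqP n0 n.
  apply: le_trans (large G _ n (@adj_sym G) (@adj_irrefl G) cG reg n0n).
  by rewrite ler_pM2r // ge_min lexx.
have [S hS] := exists_triangle (@adj_sym G) (@adj_irrefl G) cG n_gt0 reg.
apply: (@le_trans _ _ 1); last first.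
  by rewrite ler1n card_gt0; apply/set0Pn; exists S; rewrite inE; apply/asboolP.
apply: (@le_trans _ _ ((2 ^+ (2 * n0))^-1 * 2 ^+ #|G|)).
  by rewrite ler_pM2r // ge_min lexx orbT.
by rewrite ler_pdivrMl ?exprn_gt0 // mulr1 cG ler_eXn2l ?ltr1n // leq_mul2l ltnW.
Qed.
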